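(* Let $\Lambda\in\mathcal{L}$, $c\in C^0_\Lambda$, $\hat w,w\in W^c$ and $f\in\mathbb{F}[\Lambda]$. Then $$\gamma^{qp}_w\big(\pi^{qp}(\mathbf{1}^+fT_{\hat w})x^c\big)=t(w_0)\,w_0\,\pi\big(T_{(w_0w)^{-1}}^{-1}\,\mathbf{1}^+_{W_c}\,T_{\hat w^{-1}}\big)f .$$
   Context: Let $E$ be a Euclidean space with dual $E^*$ and $\Phi\subset E^*$ a reduced irreducible root system (in its span). For $\alpha\in\Phi$, $\alpha^\vee\in E$ is the vector with $\langle y,\alpha^\vee\rangle=2\alpha(y)/\|\alpha\|^2$ for all $y\in E$. Fix simple roots $\alpha_1,\dots,\alpha_r$ and positive roots $\Phi^+$; $W$ is the finite Weyl group, with simple reflections $s_i$, acting on $E$ by $s_\alpha(y)=y-\alpha(y)\alpha^\vee$; $l$ is the length, $w_0$ the longest element. $Q^\vee$ is the coroot lattice. $\mathcal{L}$ is the set of finitely generated abelian subgroups $\Lambda\subset E$ with $Q^\vee\subseteq\Lambda$ and $\alpha(\Lambda)\subseteq\mathbb{Z}$ for all $\alpha\in\Phi$. $\mathbb{F}$ is a field; $\mathbb{F}[E]$ is the group algebra with basis $x^y$ ($y\in E$), and $\mathbb{F}[S]$ is the span of $x^y$, $y\in S$; $W$ acts by $wx^y=x^{wy}$. $\widetilde W_\Lambda=W\ltimes\Lambda$ acts on $E$ with $\Lambda$ acting by translations. $\overline{C^+}=\{y\in E:0\le\alpha(y)\le1\ \forall\alpha\in\Phi^+\}$. $C^0_\Lambda$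 is the set of $c\in\overline{C^+}$ whose stabilizer in $\widetilde W_\Lambda$ equals its stabilizer $W_c$ in $W$. $W_c$ is a standard parabolic subgroup; $W^c$ is the set of minimal length representatives of $W/W_c$. $\widetilde{\mathcal{O}}_{\Lambda,c}=\{\lambda+wc:\lambda\in\Lambda,w\in W\}$. For $c\in C^0_\Lambda$, $\mathbb{F}[\widetilde{\mathcal{O}}_{\Lambda,c}]$ is a free $\mathbb{F}[\Lambda]$-module with basis $x^{wc}$ ($w\in W^c$), and $\gamma^{qp}_w$ is defined by $f=\sum_{w\in W^c}\gamma_w^{qp}(f)x^{wc}$. Fix a $W$-invariant map $\Phi\to\mathbb{F}^\times$, $\alpha\mapsto t_\alpha$; $t_j=t_{\alpha_j}$, and $t(w)=t_{j_1}\cdots t_{j_k}$ for a reduced expression $w=s_{j_1}\cdots s_{j_k}$. For $f\in\mathbb{F}[\Lambda]$, $\nabla_j(f)=\frac{s_jf-f}{x^{\alpha_j^\vee}-1}$. The extended affine Hecke algebra $\widetilde{\mathcal{H}}_\Lambda$ is generated by $T_1,\dots,T_r$ and $x^\lambda$ ($\lambda\in\Lambda$) with: braid relations; $(T_j-t_j)(T_j+t_j^{-1})=0$; $x^\lambda x^\mu=x^{\lambda+\mu}$, $x^0=1$; $T_jx^\lambda-x^{s_j\lambda}T_j=(t_j-t_j^{-1})\nabla_j(x^\lambda)$. $T_w=T_{j_1}\cdots T_{j_k}$ for a reduced expression. $\mathbf{1}^+=\sum_{w\in W}t(w)T_w$ and $\mathbf{1}^+_{W_c}=\sum_{w\in W_c}t(w)T_w$.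 Polynomial representation $\pi$ on $\mathbb{F}[\Lambda]$: $\pi(T_j)f=t_js_jf+(t_j-t_j^{-1})\nabla_j(f)$, $\pi(x^\mu)$ multiplication by $x^\mu$. Quasi-polynomial representation $\pi^{qp}$ on $\mathbb{F}[E]$ (preserving $\mathbb{F}[\widetilde{\mathcal{O}}_{\Lambda,c}]$): $\pi^{qp}(x^\lambda)x^y=x^{\lambda+y}$ and $\pi^{qp}(T_j)x^y=\chi_j(\alpha_j(y))x^{s_jy}+(t_j-t_j^{-1})\frac{x^{y-\lfloor\alpha_j(y)\rfloor\alpha_j^\vee}-x^y}{x^{\alpha_j^\vee}-1}$, where $\chi_j(a)=t_j$ if $a\in\mathbb{Z}$ and $\chi_j(a)=1$ otherwise. *)

(* Defs.v *)
From HB Require Import structures.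
From mathcomp Require Import all_boot all_order all_algebra.
From mathcomp Require Import finmap generic_quotient sesquilinear.
From mathcomp Require Import boolp classical_sets cardinality fsbigop reals.
From mathcomp.multinomials Require Import monalg.

Set Implicit Arguments.
Unset Strict Implicit.
Unset Printing Implicit Defensive.

Import Order.TTheory GRing.Theory Num.Theory.
Local Open Scope classical_set_scope.
Local Open Scope ring_scope.
Local Open Scope quotient_scope.

(* Terms in the generators; modulo the algebra axioms alone they form the free
   associative algebra.  There is no constructor for opposites because
   [- u = (-1) *: u]. *)
Inductive fterm (F : comNzRingType) (G : Type) : Type :=
| FGen of G
| FZero
| FOne
| FAdd of fterm F G & fterm F G
| FMul of fterm F G & fterm F G
| FScale of F & fterm F G.

Arguments FGen {F G}.
Arguments FZero {F G}.
Arguments FOne {F G}.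

HB.instance Definition _ (F : comNzRingType) (G : Type) :=
  gen_eqMixin (fterm F G).
HB.instance Definition _ (F : comNzRingType) (G : Type) :=
  gen_choiceMixin (fterm F G).

Section PresentedAlgebra.
Variables (F : comNzRingType) (G : Type) (rel : fterm F G -> fterm F G -> Prop).

Inductive fcongr : fterm F G -> fterm F G -> Prop :=
| fc_rel u v : rel u v -> fcongr u v
| fc_refl u : fcongr u u
| fc_sym u v : fcongr u v -> fcongr v u
| fc_trans u v w : fcongr u v -> fcongr v w -> fcongr u w
| fc_add u u' v v' :
    fcongr u u' -> fcongr v v' -> fcongr (FAdd u v) (FAdd u' v')
| fc_mul u u' v v' :
    fcongr u u' -> fcongr v v' -> fcongr (FMul u v) (FMul u' v')
| fc_scale k u u' : fcongr u u' -> fcongr (FScale k u) (FScale k u')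
| fc_addA u v w : fcongr (FAdd u (FAdd v w)) (FAdd (FAdd u v) w)
| fc_addC u v : fcongr (FAdd u v) (FAdd v u)
| fc_add0 u : fcongr (FAdd FZero u) u
| fc_addN u : fcongr (FAdd (FScale (-1) u) u) FZero
| fc_mulA u v w : fcongr (FMul u (FMul v w)) (FMul (FMul u v) w)
| fc_mul1l u : fcongr (FMul FOne u) u
| fc_mul1r u : fcongr (FMul u FOne) u
| fc_mulDl u v w : fcongr (FMul (FAdd u v) w) (FAdd (FMul u w) (FMul v w))
| fc_mulDr u v w : fcongr (FMul u (FAdd v w)) (FAdd (FMul u v) (FMul u w))
| fc_scaleA k l u : fcongr (FScale k (FScale l u)) (FScale (k * l) u)
| fc_scale1 u : fcongr (FScale 1 u) u
| fc_scaleDr k u v :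
    fcongr (FScale k (FAdd u v)) (FAdd (FScale k u) (FScale k v))
| fc_scaleDl k l u :
    fcongr (FScale (k + l) u) (FAdd (FScale k u) (FScale l u))
| fc_scaleAl k u v : fcongr (FScale k (FMul u v)) (FMul (FScale k u) v)
| fc_scaleAr k u v : fcongr (FScale k (FMul u v)) (FMul u (FScale k v)).

Definition fcongrb (u v : fterm F G) : bool := `[< fcongr u v >].

Lemma fcongrb_refl : reflexive fcongrb.
Proof. by move=> u; apply/asboolP; apply: fc_refl. Qed.
Lemma fcongrb_sym : symmetric fcongrb.
Proof. by move=> u v; apply/asboolP/asboolP; apply: fc_sym. Qed.
Lemma fcongrb_trans : transitive fcongrb.
Proof.
by move=> v u w /asboolP uv /asboolP vw; apply/asboolP; apply: fc_trans vw.
Qed.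

Canonical fcongr_equiv := EquivRel fcongrb fcongrb_refl fcongrb_sym fcongrb_trans.

Definition presented : Type := {eq_quot fcongr_equiv}.
HB.instance Definition _ : EqQuotient _ fcongr_equiv presented :=
  EqQuotient.on presented.
HB.instance Definition _ := Choice.on presented.

Definition pres (u : fterm F G) : presented := \pi_presented u.

Lemma presP (u v : fterm F G) : pres u = pres v <-> fcongr u v.
Proof.
split=> [/eqquotP/asboolP //|uv]; by apply/eqquotP/asboolP.
Qed.

Lemma repr_pres (u : fterm F G) : fcongr (repr (pres u)) u.
Proof. by apply/presP; rewrite /pres reprK. Qed.

Lemma pres_ind (P : presented -> Prop) : (forall u, P (pres u)) -> forall x, P x.
Proof. by move=> h x; rewrite -[x]reprK; apply: h. Qed.

Let padd (x y : presented) := pres (FAdd (repr x) (repr y)).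
Let pmul (x y : presented) := pres (FMul (repr x) (repr y)).
Let pscale (k : F) (x : presented) := pres (FScale k (repr x)).
Let popp (x : presented) := pscale (-1) x.

Let paddE u v : padd (pres u) (pres v) = pres (FAdd u v).
Proof. by apply/presP; apply: fc_add; apply: repr_pres. Qed.
Let pmulE u v : pmul (pres u) (pres v) = pres (FMul u v).
Proof. by apply/presP; apply: fc_mul; apply: repr_pres. Qed.
Let pscaleE k u : pscale k (pres u) = pres (FScale k u).
Proof. by apply/presP; apply: fc_scale; apply: repr_pres. Qed.

Let paddA : associative padd.
Proof.
elim/pres_ind=> u; elim/pres_ind=> v; elim/pres_ind=> w; rewrite !paddE.
by apply/presP; apply: fc_addA.
Qed.
Let paddC : commutative padd.
Proof.
by elim/pres_ind=> u; elim/pres_ind=> v; rewrite !paddE; apply/presP/fc_addC.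
Qed.
Let padd0 : left_id (pres FZero) padd.
Proof. by elim/pres_ind=> u; rewrite paddE; apply/presP/fc_add0. Qed.
Let paddN : left_inverse (pres FZero) popp padd.
Proof.
by elim/pres_ind=> u; rewrite /popp pscaleE paddE; apply/presP/fc_addN.
Qed.

HB.instance Definition _ := GRing.isZmodule.Build presented paddA paddC padd0 paddN.

Let pmulA : associative pmul.
Proof.
elim/pres_ind=> u; elim/pres_ind=> v; elim/pres_ind=> w; rewrite !pmulE.
by apply/presP/fc_mulA.
Qed.
Let pmul1l : left_id (pres FOne) pmul.
Proof. by elim/pres_ind=> u; rewrite pmulE; apply/presP/fc_mul1l. Qed.
Let pmul1r : right_id (pres FOne) pmul.
Proof. by elim/pres_ind=> u; rewrite pmulE; apply/presP/fc_mul1r. Qed.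
Let pmulDl : left_distributive pmul padd.
Proof.
elim/pres_ind=> u; elim/pres_ind=> v; elim/pres_ind=> w.
by rewrite !(paddE, pmulE); apply/presP/fc_mulDl.
Qed.
Let pmulDr : right_distributive pmul padd.
Proof.
elim/pres_ind=> u; elim/pres_ind=> v; elim/pres_ind=> w.
by rewrite !(paddE, pmulE); apply/presP/fc_mulDr.
Qed.

(* Only a [pzRingType]: nontriviality depends on the relations. *)
HB.instance Definition _ := GRing.Zmodule_isPzRing.Build presented
  pmulA pmul1l pmul1r pmulDl pmulDr.

Let pscaleA k l x : pscale k (pscale l x) = pscale (k * l) x.
Proof. by elim/pres_ind: x => u; rewrite !pscaleE; apply/presP/fc_scaleA. Qed.
Let pscale1 : left_id 1 pscale.
Proof. by elim/pres_ind=> u; rewrite pscaleE; apply/presP/fc_scale1. Qed.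
Let pscaleDr : right_distributive pscale +%R.
Proof.
move=> k; elim/pres_ind=> u; elim/pres_ind=> v.
have addE x y : x + y = padd x y by [].
by rewrite !addE paddE !pscaleE paddE; apply/presP/fc_scaleDr.
Qed.
Let pscaleDl x : {morph pscale^~ x : k l / k + l}.
Proof.
elim/pres_ind: x => u k l; have addE x y : x + y = padd x y by [].
by rewrite addE !pscaleE paddE; apply/presP/fc_scaleDl.
Qed.

HB.instance Definition _ := GRing.Zmodule_isLmodule.Build F presented
  pscaleA pscale1 pscaleDr pscaleDl.

Definition gen (g : G) : presented := pres (FGen g).

Lemma pres0 : pres FZero = 0. Proof. by []. Qed.
Lemma pres1 : pres FOne = 1. Proof. by []. Qed.
Lemma presD u v : pres (FAdd u v) = pres u + pres v.
Proof. by rewrite -[RHS]/(padd _ _) paddE. Qed.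
Lemma presM u v : pres (FMul u v) = pres u * pres v.
Proof. by rewrite -[RHS]/(pmul _ _) pmulE. Qed.
Lemma presZ k u : pres (FScale k u) = k *: pres u.
Proof. by rewrite -[RHS]/(pscale _ _) pscaleE. Qed.

Lemma presented_scalerAl k (x y : presented) : k *: (x * y) = (k *: x) * y.
Proof.
elim/pres_ind: x => u; elim/pres_ind: y => v.
transitivity (pres (FScale k (FMul u v))); first by rewrite presZ presM.
by rewrite ((presP _ _).2 (fc_scaleAl _ _ _)) presM presZ.
Qed.
Lemma presented_scalerAr k (x y : presented) : k *: (x * y) = x * (k *: y).
Proof.
elim/pres_ind: x => u; elim/pres_ind: y => v.
transitivity (pres (FScale k (FMul u v))); first by rewrite presZ presM.
by rewrite ((presP _ _).2 (fc_scaleAr _ _ _)) presM presZ.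
Qed.

End PresentedAlgebra.

Definition gralg (F : fieldType) (E : zmodType) : Type := {malg F[E]}.

(* x^y is [<< y >>].  [monalg] itself puts a ring structure only on algebras of
   monoids without units other than 1, which excludes groups. *)
Section GroupAlgebra.
Variables (F : fieldType) (E : zmodType).
Local Notation A := (gralg F E).

HB.instance Definition _ := GRing.Lmodule.on A.

Definition xpow (y : E) : A := << y >>.

Let gmul (f g : A) : A :=
  \sum_(y <- msupp f) \sum_(z <- msupp g) << f@_y * g@_z *g y + z >>.

Let gmulw (d1 d2 : {fset E}) (f g : A) :
  (msupp f `<=` d1)%fset -> (msupp g `<=` d2)%fset ->
  gmul f g = \sum_(y <- d1) \sum_(z <- d2) << f@_y * g@_z *g y + z >>.
Proof.
move=> le1 le2; rewrite /gmul (big_fset_incl _ le1) /=.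
  apply: eq_bigr => y _; apply: (big_fset_incl _ le2) => z _ /mcoeff_outdom ->.
  by rewrite mulr0 monalgU0.
move=> y _ /mcoeff_outdom fy; rewrite big1 // => z _.
by rewrite fy mul0r monalgU0.
Qed.

Let gmulC : commutative gmul.
Proof.
move=> f g; rewrite /gmul exchange_big; apply: eq_bigr => z _.
by apply: eq_bigr => y _; rewrite mulrC addrC.
Qed.

Let gmulDl : left_distributive gmul +%R.
Proof.
move=> f g h; have sub := fsubset_refl (msupp h).
rewrite (gmulw (msuppD_le f g) sub) (gmulw (fsubsetUl _ (msupp g)) sub).
rewrite (gmulw (fsubsetUr (msupp f) _) sub) -big_split /=; apply: eq_bigr => y _.
rewrite -big_split /=; apply: eq_bigr => z _.
by rewrite mcoeffD mulrDl monalgUD.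
Qed.

Let gmul0l g : gmul 0 g = 0.
Proof. by rewrite /gmul msupp0 big_seq_fset0. Qed.

Let gmulUU k l y z :
  gmul << k *g y >> << l *g z >> = << k * l *g y + z >>.
Proof. by rewrite (gmulw msuppU_le msuppU_le) !big_seq_fset1 !mcoeffUU. Qed.

Let gmul_suml I (s : seq I) (f : I -> A) g :
  gmul (\sum_(i <- s) f i) g = \sum_(i <- s) gmul (f i) g.
Proof. exact: (big_morph (gmul^~ g) (fun _ _ => gmulDl _ _ _) (gmul0l g)). Qed.

Let gmul_sumr I (s : seq I) (f : I -> A) g :
  gmul g (\sum_(i <- s) f i) = \sum_(i <- s) gmul g (f i).
Proof. by rewrite gmulC gmul_suml; apply: eq_bigr => i _; rewrite gmulC. Qed.

Let gmulA : associative gmul.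
Proof.
move=> f g h; pose U (f : A) y : A := << f@_y *g y >>.
have E3 (f' : A) : f' = \sum_(y <- msupp f') U f' y by exact: monalgE.
rewrite [in LHS](E3 f) [in X in _ = gmul X _](E3 f).
rewrite (gmul_suml _ (U f) g) !(gmul_suml (msupp f) _ _).
apply: eq_bigr => y _; rewrite [in LHS](E3 g) [in X in _ = gmul X _](E3 g).
rewrite (gmul_suml _ (U g) h) (gmul_sumr _ (U g) (U f y)).
rewrite (gmul_sumr (msupp g) _ (U f y)) (gmul_suml (msupp g) _ h).
apply: eq_bigr => z _; rewrite [in LHS](E3 h) [in RHS](E3 h).
rewrite (gmul_sumr _ (U h) (U g z)) !(gmul_sumr (msupp h) _ _).
by apply: eq_bigr => u _; rewrite !gmulUU mulrA addrA.
Qed.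

Let gmul1l : left_id (xpow 0) gmul.
Proof.
move=> f; rewrite (monalgE f) gmul_sumr; apply: eq_bigr => y _.
by rewrite gmulUU mul1r add0r.
Qed.

Let xpow0_neq0 : xpow 0 != 0.
Proof. by rewrite monalgU_eq0 oner_eq0. Qed.

HB.instance Definition _ := GRing.Zmodule_isComNzRing.Build A
  gmulA gmulC gmul1l gmulDl xpow0_neq0.

Lemma xpow0 : xpow 0 = 1. Proof. by []. Qed.

Lemma gralg_mulUU k l (y z : E) :
  (<< k *g y >> : A) * (<< l *g z >> : A) = << k * l *g y + z >>.
Proof. exact: gmulUU. Qed.

Lemma xpowD y z : xpow (y + z) = xpow y * xpow z.
Proof. by rewrite /xpow gralg_mulUU mulr1. Qed.

Lemma gralgE (f : A) : f = \sum_(y <- msupp f) f@_y *: xpow y.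
Proof.
rewrite {1}(monalgE f); apply: eq_bigr => y _; apply/malgP => z.
by rewrite mcoeffU -[RHS]/(_@_z) mcoeffZ mcoeffU mulrnAr mulr1.
Qed.

Let gscaleE k (f : A) : k *: f = (<< k *g 0 >> : A) * f.
Proof.
have scaleU l (y : E) : k *: (<< l *g y >> : A) = << k * l *g y >>.
  by apply/malgP => z; rewrite -[LHS]/(_@_z) mcoeffZ !mcoeffU mulrnAr.
have {1 2}-> : f = \sum_(y <- msupp f) (<< f@_y *g y >> : A) by exact: monalgE.
rewrite scaler_sumr mulr_sumr; apply: eq_bigr => y _.
by rewrite scaleU gralg_mulUU add0r.
Qed.

Let gscaleAl k (f g : A) : k *: (f * g) = (k *: f) * g.
Proof. by rewrite !gscaleE mulrA. Qed.

HB.instance Definition _ := GRing.Lmodule_isLalgebra.Build F A gscaleAl.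
HB.instance Definition _ := GRing.Lalgebra_isComAlgebra.Build F A.

(* F[S], the span of the x^y for y in S *)
Definition gralg_on (S : set E) : set A := 
  [set f | forall y, y \in msupp f -> S y].

(* f / g, for g nonzero dividing f: the quotient is unique when E is
   torsion-free, F[E] then being a domain *)
Definition gdiv (f g : A) : A := xget 0 [set h | h * g = f].

End GroupAlgebra.

Section RootSystem.
Variables (R : realType) (E : vectType R) (dot : {dot E for idfun}).
Local Notation dual := 'Hom(E, R^o).

(* the isomorphism E^* -> E given by the inner product *)
Definition riesz (b : dual) : E := xget 0 [set v | forall y, dot y v = b y].

Definition dual_dot (b b' : dual) : R := dot (riesz b) (riesz b').

Definition coroot (b : dual) : E :=
  xget 0 [set v | forall y, dot y v = 2 * b y / dual_dot b b].

Definition refl_fun (b : dual) (y : E) : E := y - b y *: coroot b.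

Lemma refl_fun_is_linear b : linear (refl_fun b).
Proof.
move=> k u v; rewrite /refl_fun linearP scalerDl scalerBr scalerA opprD.
by rewrite addrACA.
Qed.

HB.instance Definition _ b :=
  GRing.isLinear.Build R E E _ (refl_fun b) (refl_fun_is_linear b).

Definition refl (b : dual) : 'End(E) := linfun (refl_fun b).

Lemma reflE b y : refl b y = y - b y *: coroot b.
Proof. exact: lfunE. Qed.

Record irreducible_reduced_root_system (Phi : set dual) : Prop := {
  rs_finite : finite_set Phi;
  rs_neq0 : ~ Phi 0;
  rs_refl : forall b b', Phi b -> Phi b' -> Phi (b' \o refl b)%VF;
  rs_int : forall b b', Phi b -> Phi b' -> b' (coroot b) \is a Num.int;
  rs_reduced : forall b (k : R), Phi b -> Phi (k *: b) -> k = 1 \/ k = -1;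
  rs_nonempty : Phi !=set0;
  rs_irreducible : forall A B : set dual,
    A `|` B = Phi -> A `&` B = set0 ->
    (forall b b', A b -> B b' -> dual_dot b b' = 0) ->
    A = set0 \/ B = set0 }.

Definition natcomb (r : nat) (a : 'I_r -> dual) : set dual :=
  [set b | exists n : 'I_r -> nat, b = \sum_i a i *+ n i].

Record simple_roots (Phi : set dual) (r : nat) (a : 'I_r -> dual) : Prop := {
  sr_sub : forall i, Phi (a i);
  sr_free : free [seq a i | i <- enum 'I_r];
  sr_comb : forall b, Phi b -> natcomb a b \/ natcomb a (- b) }.

Section Weyl.
Variables (Phi : set dual) (r : nat) (a : 'I_r -> dual).

Definition positive_roots : set dual := Phi `&` natcomb a.

Definition weyl : set 'End(E) :=
  [set w | exists2 s : seq dual, (forall b, b \in s -> Phi b) &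
             w = foldr (fun b u => refl b \o u)%VF \1%VF s].

Definition word (s : seq 'I_r) : 'End(E) :=
  foldr (fun j u => refl (a j) \o u)%VF \1%VF s.

Definition reduced (s : seq 'I_r) : Prop :=
  forall s', word s' = word s -> (size s <= size s')%N.

(* a chosen reduced expression; t(w) and T_w below do not depend on the choice *)
Definition redexpr (w : 'End(E)) : seq 'I_r :=
  xget [::] [set s | word s = w /\ reduced s].

Definition wlength (w : 'End(E)) : nat := size (redexpr w).

Definition longest : 'End(E) :=
  xget \1%VF [set w | weyl w /\ forall u, weyl u -> (wlength u <= wlength w)%N].

Definition weyl_stab (c : E) : set 'End(E) := weyl `&` [set w | w c = c].

Definition min_reps (c : E) : set 'End(E) :=
  [set w | weyl w /\
     forall u, weyl_stab c u -> (wlength w <= wlength (w \o u)%VF)%N].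

Definition is_subgroup (L : set E) : Prop :=
  L 0 /\ forall x y, L x -> L y -> L (x - y).

Definition coroot_lattice : set E := smallest is_subgroup (coroot @` Phi).

Record admissible_lattice (L : set E) : Prop := {
  al_fg : exists s : seq E, L = smallest is_subgroup [set` s];
  al_coroot : coroot_lattice `<=` L;
  al_int : forall b y, Phi b -> L y -> b y \is a Num.int }.

(* (w, l) stands for the element of W |x L acting by y |-> l + w y *)
Definition affine_stab (L : set E) (c : E) : set ('End(E) * E) :=
  [set p | [/\ weyl p.1, L p.2 & p.2 + p.1 c = c]].

Definition closed_alcove : set E :=
  [set y | forall b, positive_roots b -> 0 <= b y <= 1].

Definition C0 (L : set E) : set E :=
  [set c | closed_alcove c /\
     affine_stab L c = [set (w, 0) | w in weyl_stab c]].

Section Hecke.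
Variables (F : fieldType) (t : dual -> F) (L : set E).
Local Notation A := (gralg F E).

Definition weyl_invariant : Prop :=
  (forall b, Phi b -> t b != 0) /\
  (forall b w, Phi b -> weyl w -> t (b \o w^-1)%VF = t b).

Definition tw (w : 'End(E)) : F := \prod_(j <- redexpr w) t (a j).

(* w x^y = x^(w y), extended linearly *)
Definition wact (w : 'End(E)) (f : A) : A :=
  \sum_(y <- msupp f) f@_y *: xpow F (w y).

Definition nabla (j : 'I_r) (f : A) : A :=
  gdiv (wact (refl (a j)) f - f) (xpow F (coroot (a j)) - 1).

Inductive hecke_gen : Type :=
| GenT of 'I_r
| GenX of L.

Local Notation term := (fterm F hecke_gen).
Local Notation termT := (fun j => FGen (GenT j) : term).
Local Notation termX := (fun l => FGen (GenX l) : term).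

Definition term_gralg (f : A) : term :=
  foldr (fun y u => FAdd (FScale f@_y (oapp termX FZero (insub y))) u)
    FZero (msupp f).

(* T_i T_j T_i ... with m factors *)
Definition term_braid (m : nat) (i j : 'I_r) : term :=
  foldr (fun k u => FMul (termT (if odd k then j else i)) u) FOne (iota 0 m).

Definition is_order (u : 'End(E)) (m : nat) : Prop :=
  [/\ (0 < m)%N, iter m (comp_lfun u) \1%VF = \1%VF &
      forall k, (0 < k < m)%N -> iter k (comp_lfun u) \1%VF <> \1%VF].

Inductive hecke_rel : term -> term -> Prop :=
| hr_braid i j m : i != j -> is_order (refl (a i) \o refl (a j))%VF m ->
    hecke_rel (term_braid m i j) (term_braid m j i)
| hr_quad j :
    hecke_rel (FMul (FAdd (termT j) (FScale (- t (a j)) FOne))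
                    (FAdd (termT j) (FScale (t (a j))^-1 FOne))) FZero
| hr_mul (l m n : L) : \val n = \val l + \val m ->
    hecke_rel (FMul (termX l) (termX m)) (termX n)
| hr_one (l : L) : \val l = 0 -> hecke_rel (termX l) FOne
| hr_cross j (l m : L) : \val m = refl (a j) (\val l) ->
    hecke_rel
      (FAdd (FMul (termT j) (termX l))
            (FScale (-1) (FMul (termX m) (termT j))))
      (FScale (t (a j) - (t (a j))^-1)
              (term_gralg (nabla j (xpow F (\val l))))).

Definition hecke : Type := presented hecke_rel.
HB.instance Definition _ := GRing.PzRing.on hecke.
HB.instance Definition _ := GRing.Lmodule.on hecke.

Definition heckeT (j : 'I_r) : hecke := gen hecke_rel (GenT j).

Definition heckeX (l : L) : hecke := gen hecke_rel (GenX l).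

(* the canonical map F[L] -> hecke; the points of msupp f outside L, of which
   there are none when f is in F[L], are dropped *)
Definition hecke_gralg (f : A) : hecke :=
  \sum_(y <- msupp f) f@_y *: oapp heckeX 0 (insub y).

Definition heckeTw (w : 'End(E)) : hecke := \prod_(j <- redexpr w) heckeT j.

Definition hecke_inv (h : hecke) : hecke :=
  xget 0 [set h' | h * h' = 1 /\ h' * h = 1].

Definition symmetrizer (S : set 'End(E)) : hecke :=
  \sum_(w \in S) tw w *: heckeTw w.

(* rho makes the linear subspace V of F[E] a left module over the Hecke algebra;
   nothing is said of rho outside V *)
Record representation_on (V : set A) (rho : hecke -> A -> A) : Prop := {
  rep_stable : forall h f, V f -> V (rho h f);
  rep_linear : forall h k f g, V f -> V g ->
    rho h (k *: f + g) = k *: rho h f + rho h g;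
  rep_linearl : forall k h h' f, V f ->
    rho (k *: h + h') f = k *: rho h f + rho h' f;
  rep1 : forall f, V f -> rho 1 f = f;
  repM : forall h h' f, V f -> rho (h * h') f = rho h (rho h' f) }.

Lemma hecke_braid i j m : i != j -> is_order (refl (a i) \o refl (a j))%VF m ->
  \prod_(k <- iota 0 m) heckeT (if odd k then j else i) =
  \prod_(k <- iota 0 m) heckeT (if odd k then i else j).
Proof.
have prodE i' j' : \prod_(k <- iota 0 m) heckeT (if odd k then j' else i') =
    pres hecke_rel (term_braid m i' j').
  rewrite /term_braid; elim: (iota 0 m) => [|k s IH]; first by rewrite big_nil.
  by rewrite big_cons IH /= presM.
by move=> ij mij; rewrite !prodE; apply/presP/fc_rel/hr_braid.
Qed.

Lemma hecke_quad j :
  (heckeT j - t (a j) *: (1 : hecke)) *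
  (heckeT j + (t (a j))^-1 *: (1 : hecke)) = 0.
Proof.
have /fc_rel/presP := hr_quad j.
by rewrite presM !presD !presZ scaleNr.
Qed.

Lemma heckeXM (l m n : L) :
  \val n = \val l + \val m -> heckeX l * heckeX m = heckeX n.
Proof.
move=> e; rewrite -[LHS](presM hecke_rel (FGen (GenX l)) (FGen (GenX m))).
exact/presP/fc_rel/hr_mul.
Qed.

Lemma heckeX0 (l : L) : \val l = 0 -> heckeX l = 1.
Proof. by move=> e; apply/presP/fc_rel/hr_one. Qed.

Lemma hecke_cross j (l m : L) : \val m = refl (a j) (\val l) ->
  heckeT j * heckeX l - heckeX m * heckeT j =
  (t (a j) - (t (a j))^-1) *: hecke_gralg (nabla j (xpow F (\val l))).
Proof.
move=> e; have /fc_rel/presP := hr_cross e.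
rewrite presD presM !presZ presM scaleN1r => ->; congr (_ *: _).
rewrite /term_gralg /hecke_gralg.
elim: (enum_fset _) => [|y s IH]; first by rewrite big_nil.
rewrite big_cons /= presD IH presZ; congr (_ *: _ + _).
by case: insub.
Qed.

Record polynomial_representation (rho : hecke -> A -> A) : Prop := {
  pr_rep : representation_on (gralg_on L) rho;
  pr_T : forall j f, gralg_on L f ->
    rho (heckeT j) f =
      t (a j) *: wact (refl (a j)) f + (t (a j) - (t (a j))^-1) *: nabla j f;
  pr_X : forall (l : L) f, gralg_on L f ->
    rho (heckeX l) f = xpow F (\val l) * f }.

Definition chi (j : 'I_r) (k : R) : F :=
  if k \is a Num.int then t (a j) else 1.

Record quasi_polynomial_representation (rho : hecke -> A -> A) : Prop := {
  qpr_rep : representation_on setT rho;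
  qpr_X : forall (l : L) y, rho (heckeX l) (xpow F y) = xpow F (\val l + y);
  qpr_T : forall j y,
    rho (heckeT j) (xpow F y) =
      chi j (a j y) *: xpow F (refl (a j) y)
      + (t (a j) - (t (a j))^-1) *:
          gdiv (xpow F (y - coroot (a j) *~ Num.floor (a j y)) - xpow F y)
               (xpow F (coroot (a j)) - 1) }.

(* coordinates of g in the F[L]-basis x^(wc), w in W^c, of the span of the
   x^y for y in the affine orbit of c; only the values on W^c are meaningful *)
Definition gamma_qp (c : E) (w : 'End(E)) (g : A) : A :=
  xget (fun _ => 0)
    [set d : 'End(E) -> A |
       (forall u, min_reps c u -> gralg_on L (d u)) /\
       g = \sum_(u \in min_reps c) d u * xpow F (u c)] w.

End Hecke.
End Weyl.
End RootSystem.

(* Main.v *)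
From HB Require Import structures.
Require Import Defs.
From mathcomp Require Import all_boot all_order all_algebra.
From mathcomp Require Import finmap sesquilinear boolp classical_sets.
From mathcomp Require Import cardinality fsbigop reals ring lra zify.
From mathcomp.multinomials Require Import monalg.

(* Write k_j = t_j - t_j^-1. Since 1^+ T_j = t_j 1^+, the cross relation gives
   1^+ f T_j = 1^+ pi(T_j)f, so T_wh may be absorbed into g = pi(T_(wh^-1))f,
   and it remains to expand G = piqp(1^+ g) x^c. As T_j G = t_j G, comparing
   coefficients of x^y for a_j(y) < 0 expresses the coefficient at s_j y by the
   one at y, so all of them follow from the coefficient at the antidominant
   point w_0 c. That one comes only from the terms T_v of 1^+ with v c = w_0 c,
   and T_u acts on F[L] x^c as pi(T_u) for u in W_c. Both sides of the theorem
   thus satisfy the same recursion with the same initial value. *)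

Local Open Scope classical_set_scope.
Local Open Scope ring_scope.

(** * Group algebras *)

Section GroupAlgebraTheory.
Set Implicit Arguments.
Unset Strict Implicit.
Unset Printing Implicit Defensive.
Import Order.TTheory GRing.Theory Num.Theory.

Section LinearExtension.
Variables (F : fieldType) (E : zmodType) (V : lmodType F).
Local Notation A := (gralg F E).

(** The condition on [c] is used twice: it forces |b(wc)| < 1 for every root b, so that T_j maps
    x^(wc) into the span of x^(wc) and x^(s_j wc), and it keeps distinct points of Wc incongruent
    modulo [L], so that coefficients at different points do not mix. The right-hand side obeys the
    recursion because conjugation by w_0 takes s_j to a simple s_j' with a_j' = - a_j w_0. Then w_0
    w = s_j' (w_0 s_j w) with lengths adding, a factor T_j'^-1 splits off, and w_0 nabla_j' = - s_j
    nabla_j w_0 turns it into the formula that T_j G = t_j G yields. The initial values agree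
    because, for wc antidominant, w_0 w lies in W_c, and pi(1^+_(W_c)) g is both fixed by W_c and an
    eigenvector of each T_u, u in W_c, with eigenvalue t(u). Its invariance comes from cancelling
    the nonzerodivisor t_j^2 x^(co_j) - 1. Since T_w and t(w) are defined through a chosen reduced
    expression, their multiplicativity rests on Matsumoto's theorem, derived below from the exchange
    property. *)

Definition lin_ext (phi : E -> V) (f : A) : V := \sum_(y <- msupp f) f@_y *: phi y.

Lemma lin_extw (phi : E -> V) (f : A) (d : {fset E}) : (msupp f `<=` d)%fset ->
  lin_ext phi f = \sum_(y <- d) f@_y *: phi y.
Proof.
move=> fd; apply: (big_fset_incl _ fd) => y _ /mcoeff_outdom ->.
by rewrite scale0r.
Qed.

Lemma gcoeffZD (k : F) (f g : A) y : (k *: f + g)@_y = k * f@_y + g@_y.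
Proof.
by rewrite -[LHS]/(mcoeff y (_ + _)) mcoeffD -[X in X + _]/(mcoeff y (_ *: _)) mcoeffZ.
Qed.

Lemma gcoeffX (y z : E) : (xpow F y)@_z = (y == z)%:R.
Proof. by rewrite /xpow mcoeffU. Qed.

(** [wact], [hecke_gralg] and [lcoef] unfold to instances of [lin_ext], and get their linearity from
    here. The supports of the three elements differ, so all sums are first taken over one common
    finite set. *)
Lemma lin_ext_linear phi : linear (lin_ext phi).
Proof.
move=> k f g.
pose d := (msupp f `|` msupp g)%fset.
have sub : (msupp (k *: f + g : A) `<=` d)%fset.
  apply/fsubsetP => y; rewrite inE -!mcoeff_neq0 gcoeffZD.
  by apply: contraNT; rewrite negb_or !negbK => /andP[/eqP-> /eqP->]; rewrite mulr0 addr0.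
rewrite (lin_extw phi sub) (lin_extw phi (fsubsetUl (msupp f) (msupp g))).
rewrite (lin_extw phi (fsubsetUr (msupp f) (msupp g))) scaler_sumr -big_split /=.
by apply: eq_bigr => y _; rewrite gcoeffZD scalerDl scalerA.
Qed.

Lemma lin_extX phi y : lin_ext phi (xpow F y) = phi y.
Proof.
have sub : (msupp (xpow F y) `<=` [fset y])%fset by exact: msuppU_le.
by rewrite (lin_extw phi sub) big_seq_fset1 gcoeffX eqxx scale1r.
Qed.

End LinearExtension.

Section GroupAlgebraBasics.
Variables (F : fieldType) (E : zmodType).
Local Notation A := (gralg F E).

Lemma gralg_on_lin (S : set E) k (f g : A) :
  gralg_on S f -> gralg_on S g -> gralg_on S (k *: f + g).
Proof.
move=> Sf Sg y; rewrite -mcoeff_neq0 gcoeffZD => ny.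
have [fy|] := boolP (y \in msupp f); first exact: Sf.
rewrite -mcoeff_neq0 negbK => /eqP f0; apply: Sg; rewrite -mcoeff_neq0.
by move: ny; rewrite f0 mulr0 add0r.
Qed.

Lemma gralg_on0 (S : set E) : gralg_on S (0 : A).
Proof. by move=> y; rewrite -mcoeff_neq0 mcoeff0 eqxx. Qed.

Lemma gralg_onD (S : set E) (f g : A) : gralg_on S f -> gralg_on S g -> gralg_on S (f + g).
Proof. by move=> Sf Sg; rewrite -[f]scale1r; apply: gralg_on_lin. Qed.

Lemma gralg_onZ (S : set E) k (f : A) : gralg_on S f -> gralg_on S (k *: f).
Proof. by move=> Sf; rewrite -[_ *: _]addr0; apply: gralg_on_lin => //; exact: gralg_on0. Qed.

Lemma gralg_onN (S : set E) (f : A) : gralg_on S f -> gralg_on S (- f).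
Proof. by move=> Sf; rewrite -scaleN1r; apply: gralg_onZ. Qed.

Lemma gralg_onX (S : set E) y : S y -> gralg_on S (xpow F y).
Proof.
move=> Sy z; rewrite -mcoeff_neq0 gcoeffX.
by have [<-//|_] := eqVneq y z; rewrite eqxx.
Qed.

Lemma gralg_ind (S : set E) (P : A -> Prop) :
  P 0 -> (forall k y f, S y -> P f -> P (k *: xpow F y + f)) ->
  forall f, gralg_on S f -> P f.
Proof.
move=> P0 PD f Sf; rewrite (gralgE f) big_seq.
elim/big_rec: _ => // y g yf Pg; apply: PD => //; exact: Sf.
Qed.

Lemma gralg_indT (P : A -> Prop) :
  P 0 -> (forall k y f, P f -> P (k *: xpow F y + f)) -> forall f, P f.
Proof.
move=> P0 PD f.
by apply: (@gralg_ind setT P) => // k y g _; apply: PD.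
Qed.

Lemma linear_gralg_eq (V : lmodType F) (S : set E) (p q : A -> V) :
  linear p -> linear q -> (forall y, S y -> p (xpow F y) = q (xpow F y)) ->
  forall f, gralg_on S f -> p f = q f.
Proof.
move=> lp lq e; have l0 (u : A -> V) : linear u -> u 0 = 0.
  by move=> lu; have := lu (-1) 0 0; rewrite scaler0 addr0 scaleN1r addNr.
apply: gralg_ind => [|k y f Sy IH]; first by rewrite (l0 p) ?(l0 q).
by rewrite lp lq IH e.
Qed.

End GroupAlgebraBasics.

(** * Division by x^v - 1 and coefficients over a lattice *)

Section Lattices.
Variables (R : realType) (E : vectType R) (F : fieldType).
Local Notation A := (gralg F E).

Lemma subgroupN (S : set E) x : is_subgroup S -> S x -> S (- x).
Proof. by move=> [S0 SB] Sx; rewrite -sub0r; apply: SB. Qed.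

Lemma subgroupD (S : set E) x y : is_subgroup S -> S x -> S y -> S (x + y).
Proof.
move=> Sgp Sx Sy; have [_ SB] := Sgp.
by rewrite -[y]opprK; apply: SB => //; apply: subgroupN.
Qed.

Lemma gralg_onM (S : set E) (f g : A) : is_subgroup S ->
  gralg_on S f -> gralg_on S g -> gralg_on S (f * g).
Proof.
move=> Sgp Sf Sg.
move: f Sf; apply: gralg_ind => [|k y f Sy IH]; first by rewrite mul0r; exact: gralg_on0.
rewrite mulrDl -scalerAl; apply: gralg_on_lin => // {IH}.
move: g Sg; apply: gralg_ind => [|k' z g Sz IH]; first by rewrite mulr0; exact: gralg_on0.
rewrite mulrDr -scalerAr -xpowD; apply: gralg_on_lin => //; apply: gralg_onX; exact: subgroupD.
Qed.

Lemma gcoeffMX (f : A) a y : (f * xpow F a)@_y = f@_(y - a).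
Proof.
move: f; apply: gralg_indT => [|k z f IH].
  by rewrite mul0r !mcoeff0.
rewrite mulrDl -scalerAl -xpowD !gcoeffZD IH !gcoeffX; congr (_ * _%:R + _).
by rewrite -[in RHS](inj_eq (addIr a)) subrK.
Qed.

(* A nonzero coefficient would propagate along an infinite arithmetic progression. *)
Lemma binomial_regular (k : F) (v : E) (h : A) : k != 0 -> v != 0 ->
  h * (k *: xpow F v - 1) = 0 -> h = 0.
Proof.
move=> k0 v0 e; apply/malgP => y; rewrite mcoeff0; apply/eqP.
apply: contraT => hy.
have step z : h@_(z - v) * k = h@_z.
  have : (h * (k *: xpow F v - 1))@_z = 0 by rewrite e mcoeff0.
  rewrite mulrBr mulr1 -scalerAr -scaleN1r addrC gcoeffZD mulN1r.
  rewrite -[k *: _]addr0 gcoeffZD mcoeff0 addr0 gcoeffMX addrC => /eqP.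
  by rewrite subr_eq0 mulrC => /eqP.
have hn n : h@_(y - v *+ n) != 0.
  elim: n => [|n IH]; first by rewrite mulr0n subr0.
  apply: contra IH => /eqP z; rewrite -step -addrA -opprD -mulrSr z mul0r eqxx //.
(* E is a real vector space, so the nonzero v has infinite order. *)
have inj : injective (fun n => y - v *+ n).
  move=> m n /addrI/oppr_inj/eqP; rewrite -!scaler_nat -subr_eq0 -scalerBl.
  by rewrite scaler_eq0 (negPf v0) orbF subr_eq0 eqr_nat => /eqP.
have := @uniq_leq_size _ [seq y - v *+ n | n <- iota 0 (size (msupp h)).+1] (msupp h).
rewrite map_inj_uniq // iota_uniq size_map size_iota ltnn => /(_ isT) H.
by apply: H => z /mapP[n _ ->]; rewrite -mcoeff_neq0.
Qed.

(** [gdiv] picks an arbitrary quotient; as x^v - 1 is a nonzerodivisor there is at most one, so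
    exhibiting a quotient computes [gdiv]. *)
Lemma gdivE (v : E) (f h : A) : v != 0 -> h * (xpow F v - 1) = f ->
  gdiv f (xpow F v - 1) = h.
Proof.
move=> v0 e; rewrite /gdiv; case: xgetP => [h' _ /= e'|/(_ h)//].
apply/eqP; rewrite -subr_eq0; apply/eqP.
apply: (@binomial_regular 1 v) => //; first exact: oner_neq0.
by rewrite scale1r mulrBl e e' subrr.
Qed.

(** Geometric series. Locating the quotient in the multiples of v is what later keeps [nabla] inside
    F[L]. *)
Lemma geom_div (v : E) (n : int) :
  exists2 h : A, gralg_on [set v *~ m | m in setT] h & h * (xpow F v - 1) = xpow F (v *~ n) - 1.
Proof.
pose S := [set v *~ m | m in [set: int]].
have sgS : is_subgroup S.
  split; first by exists 0 => //; rewrite mulr0z.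
  by move=> _ _ [m _ <-] [p _ <-]; exists (m - p) => //; rewrite mulrzBr.
have nat n' : exists2 h : A, gralg_on S h & h * (xpow F v - 1) = xpow F (v *+ n') - 1.
  elim: n' => [|m [h Sh e]].
    by exists 0; [exact: gralg_on0|rewrite mul0r mulr0n xpow0 subrr].
  exists (xpow F v * h + 1).
    apply: gralg_onD; last by apply: gralg_onX; exists 0 => //; rewrite mulr0z.
    by apply: gralg_onM => //; apply: gralg_onX; exists 1 => //; rewrite mulr1z.
  by rewrite mulrDl -mulrA e mul1r mulrS xpowD mulrBr mulr1 addrA subrK.
case: n => m; first exact: nat.
(* For a negative exponent, x^(-pv) - 1 = - x^(-pv) (x^(pv) - 1). *)
have [h Sh e] := nat m.+1; exists (- (xpow F (v *~ Negz m) * h)).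
  apply: gralg_onN; apply: gralg_onM => //; apply: gralg_onX; by exists (Negz m).
rewrite mulNr -mulrA e mulrBr mulr1 -xpowD NegzE mulrNz -pmulrn addNr xpow0.
by rewrite opprB.
Qed.

Variables (L : set E) (Lsub : is_subgroup L).

(* The F[L]-coefficient of x^y in f. *)
Definition lcoef (y : E) (f : A) : A :=
  lin_ext (fun z => if `[< L (z - y) >] then xpow F (z - y) else 0) f.

Lemma lcoef_linear y : linear (lcoef y). Proof. exact: lin_ext_linear. Qed.

HB.instance Definition _ y :=
  GRing.isLinear.Build F A A _ (lcoef y) (lcoef_linear y).

Lemma lcoef_on y f : gralg_on L (lcoef y f).
Proof.
move: f; apply: gralg_indT => [|k z f IH].
  by rewrite linear0; exact: gralg_on0.
rewrite linearP; apply: gralg_on_lin => //; rewrite /= /lcoef lin_extX.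
by case: asboolP => [/gralg_onX//|_]; exact: gralg_on0.
Qed.

Lemma lcoefX y z : lcoef y (xpow F z) = if `[< L (z - y) >] then xpow F (z - y) else 0.
Proof. exact: lin_extX. Qed.

Lemma subgroup_shift l z : L l -> L (l + z) <-> L z.
Proof.
move=> Ll; split=> h; last exact: subgroupD.
by rewrite -[z](addKr l); apply: subgroupD => //; apply: subgroupN.
Qed.

(** Multiplying by x^l with l in [L] moves points within their class modulo [L], so the membership
    test in [lcoef] does not change. *)
Lemma lcoefM (y : E) (g h : A) : gralg_on L g -> lcoef y (g * h) = g * lcoef y h.
Proof.
have mulLlin (u : A) : linear (fun g : A => g * u).
  by move=> k g1 g2; rewrite mulrDl -scalerAl.
have mulRlin (u : A) : linear (fun g : A => u * g).
  by move=> k g1 g2; rewrite mulrDr -scalerAr.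
apply: (@linear_gralg_eq _ _ _ _ (fun g => lcoef y (g * h)) (fun g => g * lcoef y h)) => //.
  by move=> k g1 g2; rewrite mulLlin lcoef_linear.
move=> l Ll.
have : gralg_on setT h by [].
move: h; apply: (@linear_gralg_eq _ _ _ _ (fun h => lcoef y (xpow F l * h))
  (fun h => xpow F l * lcoef y h)) => //.
- by move=> k g1 g2; rewrite mulRlin lcoef_linear.
- by move=> k g1 g2; rewrite lcoef_linear mulRlin.
move=> z _; rewrite -xpowD !lcoefX -addrA.
have -> : `[< L (l + (z - y)) >] = `[< L (z - y) >].
  by apply: asbool_equiv_eq; exact: subgroup_shift.
by case: asboolP => _; [exact: xpowD|rewrite mulr0].
Qed.

End Lattices.
End GroupAlgebraTheory.

(** * Reflections in a Euclidean space *)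

Section ReflectionGroups.
Set Implicit Arguments.
Unset Strict Implicit.
Unset Printing Implicit Defensive.
Import Order.TTheory GRing.Theory Num.Theory.

Section Euclidean.
Variables (R : realType) (E : vectType R) (dot : {dot E for idfun}).
Local Notation dual := 'Hom(E, R^o).
Implicit Types (b : dual) (u v : E) (w : 'End(E)).

Lemma dotC u v : dot u v = dot v u.
Proof. by rewrite hermC expr0 mul1r. Qed.

Lemma dot_linr u : linear (dot u : E -> R^o).
Proof. by move=> k v w; rewrite linearPr. Qed.

Lemma dot_linl v : linear (fun u => dot u v : R^o).
Proof. by move=> k u z; rewrite !(dotC _ v) dot_linr. Qed.

Lemma dot0r u : dot u 0 = 0. Proof. exact: linear0r. Qed.
Lemma dotDr u v (w : E) : dot u (v + w) = dot u v + dot u w. Proof. exact: linearDr. Qed.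
Lemma dotNr u v : dot u (- v) = - dot u v. Proof. exact: linearNr. Qed.
Lemma dotBr u v (w : E) : dot u (v - w) = dot u v - dot u w.
Proof. by rewrite dotDr dotNr. Qed.
Lemma dotZr u k v : dot u (k *: v) = k * dot u v.
Proof. by rewrite -[_ *: _]addr0 dot_linr dot0r addr0. Qed.
Lemma dotBl u v (w : E) : dot (u - v) w = dot u w - dot v w.
Proof. by rewrite !(dotC _ w) dotBr. Qed.
Lemma dotZl k u v : dot (k *: u) v = k * dot u v.
Proof. by rewrite !(dotC _ v) dotZr. Qed.

Lemma dot_nondeg v : (forall y, dot y v = 0) -> v = 0.
Proof.
move=> h; apply/eqP; apply: contraT => /(@neq0_dnorm_gt0 _ _ _ dot).
by rewrite h ltxx.
Qed.

(** The map v |-> dot(., v) is injective by nondegeneracy, hence onto, since E and its dual have the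
    same dimension. *)
Lemma riesz_ex b : exists v, forall y, dot y v = b y.
Proof.
pose dl v := GRing.isLinear.Build R E R^o _ (fun u => dot u v) (dot_linl v).
pose dL v : {linear E -> R^o} := HB.pack (fun u => dot u v : R^o) (dl v).
pose phi (v : E) : 'Hom(E, R^o) := linfun (dL v).
have phiE v y : phi v y = dot y v by rewrite lfunE.
have philin : linear phi.
  move=> k u v; apply/lfunP => y.
  by rewrite add_lfunE scale_lfunE !phiE dot_linr.
pose pl := GRing.isLinear.Build R E 'Hom(E, R^o) _ phi philin.
pose Phi : {linear E -> 'Hom(E, R^o)} := HB.pack phi pl.
pose f := linfun Phi.
have fE v : f v = phi v by rewrite lfunE.
have ker0 : lker f == 0%VS.
  apply/lker0P => u v; rewrite !fE => e; apply/eqP; rewrite -subr_eq0; apply/eqP.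
  by apply: dot_nondeg => y; rewrite dotBr -!phiE e subrr.
have full : limg f = fullv.
  apply/eqP; rewrite eqEdim subvf /= limg_dim_eq; last by rewrite (eqP ker0) capv0.
  by rewrite !dimvf /dim /= muln1.
have /memv_imgP[v _ e] : b \in limg f by rewrite full memvf.
by exists v => y; rewrite e fE phiE.
Qed.

Lemma rieszE b y : dot y (riesz dot b) = b y.
Proof. have [v hv] := riesz_ex b.
by rewrite /riesz; case: xgetP => [u _ //|/(_ v)/(_ hv)]. Qed.

Lemma riesz_uniq b v : (forall y, dot y v = b y) -> riesz dot b = v.
Proof.
move=> h; apply/eqP; rewrite -subr_eq0; apply/eqP; apply: dot_nondeg => y.
by rewrite dotBr rieszE h subrr.
Qed.

Lemma dual_dot_gt0 b : b != 0 -> 0 < dual_dot dot b b.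
Proof.
move=> b0; apply: neq0_dnorm_gt0; apply: contra b0 => /eqP e.
apply/eqP/lfunP => y; rewrite -rieszE e zero_lfunE.
exact: dot0r.
Qed.

Lemma corootE b : coroot dot b = (2 / dual_dot dot b b) *: riesz dot b.
Proof.
have h y : dot y ((2 / dual_dot dot b b) *: riesz dot b) = 2 * b y / dual_dot dot b b.
  by rewrite dotZr rieszE mulrAC.
rewrite /coroot; case: xgetP => [v _ /= hv|/(_ _ h)//].
apply/eqP; rewrite -subr_eq0; apply/eqP; apply: dot_nondeg => y.
by rewrite dotBr h hv subrr.
Qed.

Lemma coroot_pair b : b != 0 -> b (coroot dot b) = 2.
Proof.
move=> b0; rewrite corootE linearZ /= -[b (riesz _ _)]rieszE -[_ *: _]/(_ * _).
by rewrite divfK // gt_eqF // dual_dot_gt0.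
Qed.

Lemma comp_refl b b' : (b' \o refl dot b)%VF = b' - b' (coroot dot b) *: b.
Proof.
apply/lfunP => y; rewrite comp_lfunE reflE linearB linearZ /=.
by rewrite add_lfunE opp_lfunE scale_lfunE; congr (_ - _); exact: mulrC.
Qed.

Lemma reflK b y : b != 0 -> refl dot b (refl dot b y) = y.
Proof.
move=> b0; rewrite (reflE _ _ (refl _ _ _)); have -> : b (refl dot b y) = - b y.
  by rewrite reflE linearB /= linearZ /= coroot_pair // /GRing.scale /=; ring.
by rewrite reflE scaleNr opprK subrK.
Qed.

Lemma refl_comp b : b != 0 -> (refl dot b \o refl dot b)%VF = \1%VF.
Proof. by move=> b0; apply/lfunP => y; rewrite comp_lfunE reflK // id_lfunE. Qed.

Definition isometric w := forall y z, dot (w y) (w z) = dot y z.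

Lemma refl_isometric b : b != 0 -> isometric (refl dot b).
Proof.
move=> b0 y z; have d0 := dual_dot_gt0 b0.
have e u : dot u (coroot dot b) = 2 / dual_dot dot b b * b u.
  by rewrite corootE dotZr rieszE.
rewrite !reflE !(dotBl, dotBr, dotZl, dotZr) (dotC (coroot dot b) z) !e.
rewrite coroot_pair //; ring.
Qed.

(** Roots are functionals and W acts on them on the right by composition; [b \o w] has Riesz vector
    w^-1(riesz b), of the same norm. Hence s_(b w) = w^-1 s_b w. *)
Lemma refl_conj w w' b : isometric w -> (w \o w' = \1)%VF ->
  (w \o refl dot (b \o w))%VF = (refl dot b \o w)%VF.
Proof.
move=> iw ww'; have wK y : w (w' y) = y by rewrite -comp_lfunE ww' id_lfunE.
have rz : riesz dot (b \o w)%VF = w' (riesz dot b).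
  by apply: riesz_uniq => y; rewrite -iw wK rieszE comp_lfunE.
have dd : dual_dot dot (b \o w)%VF (b \o w)%VF = dual_dot dot b b.
  by rewrite /dual_dot rz -iw wK.
apply/lfunP => y; rewrite !comp_lfunE !reflE linearB linearZ /= comp_lfunE.
by rewrite !corootE rz dd [w (_ *: w' _)]linearZ /= wK.
Qed.

Lemma coroot_conj w w' b : isometric w -> (w \o w' = \1)%VF ->
  w (coroot dot (b \o w)%VF) = coroot dot b.
Proof.
move=> iw ww'; have wK y : w (w' y) = y by rewrite -comp_lfunE ww' id_lfunE.
have rz : riesz dot (b \o w)%VF = w' (riesz dot b).
  by apply: riesz_uniq => y; rewrite -iw wK rieszE comp_lfunE.
by rewrite !corootE /dual_dot rz -iw wK [w (_ *: w' _)]linearZ /= wK.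
Qed.

Lemma corootN b : coroot dot (- b) = - coroot dot b.
Proof.
have rz : riesz dot (- b) = - riesz dot b.
  by apply: riesz_uniq => y; rewrite opp_lfunE dotNr rieszE.
by rewrite !corootE /dual_dot rz scalerN dotNr (dotC _ (riesz _ _)) dotNr opprK.
Qed.

Lemma reflN b : refl dot (- b) = refl dot b.
Proof.
by apply/lfunP => y; rewrite !reflE corootN opp_lfunE scalerN scaleNr opprK.
Qed.

End Euclidean.
End ReflectionGroups.

(** * Weyl groups *)

Section RootSystems.
Set Implicit Arguments.
Unset Strict Implicit.
Unset Printing Implicit Defensive.
Import Order.TTheory GRing.Theory Num.Theory.

Variables (R : realType) (E : vectType R) (dot : {dot E for idfun}).
Variables (Phi : set 'Hom(E, R^o)) (r : nat) (a : 'I_r -> 'Hom(E, R^o)).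
Hypotheses (HPhi : irreducible_reduced_root_system dot Phi) (Ha : simple_roots Phi a).
Local Notation dual := 'Hom(E, R^o).
Local Notation sr j := (refl dot (a j)).
Local Notation word := (word dot a).
Local Notation W := (weyl dot Phi).
Local Notation len := (wlength dot a).
Local Notation pos := (natcomb a).
Implicit Types (b : dual) (w : 'End(E)) (s : seq 'I_r).

Lemma root_neq0 b : Phi b -> b != 0.
Proof. by move=> Pb; apply: contra_notN (rs_neq0 HPhi) => /eqP <-. Qed.

Lemma root_refl b b' : Phi b -> Phi b' -> Phi (b' \o refl dot b)%VF.
Proof. exact: (rs_refl HPhi). Qed.

Lemma rootN b : Phi b -> Phi (- b).
Proof.
move=> Pb; have := root_refl Pb Pb; rewrite comp_refl coroot_pair ?root_neq0 //.
by rewrite scaler_nat mulr2n opprD addrA subrr add0r.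
Qed.

Lemma simple_neq0 j : a j != 0. Proof. by apply: root_neq0; apply: sr_sub Ha _. Qed.

Lemma simple_free (x : 'I_r -> R) : \sum_i x i *: a i = 0 -> forall i, x i = 0.
Proof.
move=> e; have := sr_free Ha.
have -> : [seq a i | i <- enum 'I_r] = [tuple a i | i < r] by [].
move=> /freeP/(_ x); apply; rewrite -[RHS]e; apply: eq_bigr => i _.
by rewrite (nth_map i) ?size_enum_ord // nth_ord_enum.
Qed.

Lemma simple_sumB (x y : 'I_r -> R) :
  \sum_i x i *: a i = \sum_i y i *: a i -> forall i, x i = y i.
Proof.
move=> e i; apply/eqP; rewrite -subr_eq0; apply/eqP.
apply: (simple_free (x := fun i => x i - y i)).
by under eq_bigr do rewrite scalerBl; rewrite sumrB e subrr.
Qed.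

Lemma natcombE b : pos b <-> exists n : 'I_r -> nat, b = \sum_i (n i)%:R *: a i.
Proof.
by split=> -[n ->]; exists n; apply: eq_bigr => i _; rewrite scaler_nat.
Qed.

Lemma pos_simple j : pos (a j).
Proof.
exists (fun i => (i == j)%N : nat); rewrite (bigD1 j) //= eqxx big1 ?addr0 // => i /negPf ->.
by rewrite mulr0n.
Qed.

Lemma pos0 : pos 0.
Proof. by exists (fun=> 0%N); rewrite big1 // => i _; rewrite mulr0n. Qed.

Lemma posD b b' : pos b -> pos b' -> pos (b + b').
Proof.
move=> [n ->] [m ->]; exists (fun i => n i + m i)%N.
by rewrite -big_split; apply: eq_bigr => i _; rewrite mulrnDr.
Qed.

Lemma pos_anti b : pos b -> pos (- b) -> b = 0.
Proof.
move=> /natcombE[n en] /natcombE[m em].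
have e : \sum_i ((n i)%:R + (m i)%:R) *: a i = 0.
  by under eq_bigr do rewrite scalerDl; rewrite big_split /= -en -em subrr.
rewrite en big1 // => i _; have /eqP := simple_free e i.
by rewrite -natrD pnatr_eq0 addn_eq0 => /andP[/eqP-> _]; rewrite scale0r.
Qed.

Lemma root_sign b : Phi b -> pos b \/ pos (- b). Proof. exact: sr_comb Ha _. Qed.

Lemma root_not_both b : Phi b -> pos b -> ~ pos (- b).
Proof. by move=> Pb p n; have := root_neq0 Pb; rewrite (pos_anti p n) eqxx. Qed.

(* Apart from the multiples of a_j, subtracting a multiple of a_j from a root
   leaves some coefficient unchanged, hence its sign. *)
Lemma pos_refl_simple b j : Phi b -> pos b -> b <> a j -> pos (b \o sr j)%VF.
Proof.
move=> Pb pb nb; have Pj := sr_sub Ha j; have Pb' := root_refl Pj Pb.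
case: (root_sign Pb') => // /natcombE[m em]; case: nb.
have /natcombE[n en] := pb; set k := b (coroot dot (a j)).
(* Both b and -(b s_j) are nonnegative combinations, and they add up to a multiple of a_j; so all
   coefficients away from j vanish and b is a multiple of a_j. *)
have e : \sum_i ((n i)%:R + (m i)%:R) *: a i = \sum_i (if i == j then k else 0) *: a i.
  under eq_bigr do rewrite scalerDl; rewrite big_split /= -en -em comp_refl -/k.
  rewrite opprB addrCA subrr addr0 (bigD1 j) //= eqxx big1 ?addr0 // => i /negPf ->.
  by rewrite scale0r.
have {}en : b = (n j)%:R *: a j.
  rewrite {1}en (bigD1 j) //= big1 ?addr0 // => i /negPf ij; have := simple_sumB e i.
  rewrite ij => /eqP; rewrite -natrD pnatr_eq0 addn_eq0 => /andP[/eqP-> _].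
  by rewrite scale0r.
have := rs_reduced HPhi Pj; move: Pb; rewrite en => Pb /(_ _ Pb) [->|/eqP].
  by rewrite scale1r.
by rewrite -addr_eq0 natr1 pnatr_eq0.
Qed.

(** * Words in simple reflections, length and the exchange property *)

Lemma word_cat s s' : word (s ++ s') = (word s \o word s')%VF.
Proof.
elim: s => [|j s IH] /=; first by rewrite comp_lfun1l.
by rewrite IH comp_lfunA.
Qed.

Lemma word1 j : word [:: j] = sr j. Proof. by rewrite /= comp_lfun1r. Qed.

Lemma srK j : (sr j \o sr j)%VF = \1%VF. Proof. by apply: refl_comp; exact: simple_neq0. Qed.

Lemma word_revK s : (word (rev s) \o word s)%VF = \1%VF.
Proof.
elim: s => [|j s IH] /=; first by rewrite comp_lfun1l.
rewrite rev_cons -cats1 word_cat word1 -comp_lfunA (comp_lfunA (sr j)) srK.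
by rewrite comp_lfun1l.
Qed.

Lemma word_Krev s : (word s \o word (rev s))%VF = \1%VF.
Proof. by rewrite -{1}[s]revK word_revK. Qed.

Lemma weyl_refl b : Phi b -> W (refl dot b).
Proof.
move=> Pb; exists [:: b]; last by rewrite /= comp_lfun1r.
by move=> b'; rewrite inE => /eqP->.
Qed.

Lemma weyl1 : W \1%VF. Proof. by exists [::]. Qed.

Lemma weyl_comp w w' : W w -> W w' -> W (w \o w')%VF.
Proof.
move=> [s Ps ->] [s' Ps' ->]; exists (s ++ s').
  by move=> b; rewrite mem_cat => /orP[/Ps|/Ps'].
elim: s {Ps} => [|b s IH] /=; first by rewrite comp_lfun1l.
by rewrite -IH comp_lfunA.
Qed.

Lemma weyl_word s : W (word s).
Proof.
elim: s => [|j s IH] /=; first exact: weyl1.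
by apply: weyl_comp => //; apply: weyl_refl; exact: sr_sub Ha _.
Qed.

Lemma weyl_isom w : W w -> isometric dot w.
Proof.
move=> [s Ps ->]; elim: s Ps => [|b s IH] Ps y z /=; first by rewrite !id_lfunE.
rewrite !comp_lfunE refl_isometric ?root_neq0 //; last by apply: Ps; rewrite mem_head.
by apply: IH => b' b's; apply: Ps; rewrite inE b's orbT.
Qed.

Lemma weyl_ker0 w : W w -> lker w == 0%VS.
Proof.
move=> Ww; apply/lker0P => y z e; apply/eqP; rewrite -subr_eq0; apply/eqP.
apply: (dot_nondeg (dot := dot)) => x.
by rewrite -(weyl_isom Ww) linearB /= e subrr dot0r.
Qed.

Lemma weylVK w : W w -> (w^-1 \o w)%VF = \1%VF.
Proof. by move/weyl_ker0/lker0_compVf. Qed.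

Lemma weylKV w : W w -> (w \o w^-1)%VF = \1%VF.
Proof. by move/weyl_ker0/lker0_compfV. Qed.

Lemma weyl_invE w w' : W w -> (w \o w')%VF = \1%VF -> w^-1%VF = w'.
Proof. by move=> Ww e; rewrite -[LHS]comp_lfun1r -e comp_lfunA weylVK // comp_lfun1l. Qed.

(** Induction on the height of a positive root. As |b|^2 is the sum of the n_i (b, a_i) and is
    positive, some a_j has b(co_j) > 0; then b s_j is a lower positive root and s_b = s_j s_(b s_j)
    s_j. *)
Lemma weyl_refl_word b : Phi b -> exists s, refl dot b = word s.
Proof.
move=> Pb; wlog : b Pb / pos b.
  move=> H; have [/(H b Pb)//|/(H _ (rootN Pb))] := root_sign Pb.
  by rewrite reflN.
move=> /natcombE[n en].
have [N] := ubnP (\sum_i n i)%N; elim: N b n en Pb => // N IH b n en Pb.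
rewrite ltnS => leN.
have [[j ->]|nsimple] := pselect (exists j, b = a j).
  by exists [:: j]; rewrite word1.
have [j kj] : exists j, 0 < b (coroot dot (a j)).
  apply: contrapT => nex; have := dual_dot_gt0 dot (root_neq0 Pb).
  rewrite /dual_dot rieszE {1}en sum_lfunE; apply/negP; rewrite -leNgt.
  apply: sumr_le0 => i _; rewrite scale_lfunE; apply: mulr_ge0_le0; first exact: ler0n.
  rewrite -(rieszE dot (a i)) dotC rieszE leNgt; apply/negP => bi; apply: nex; exists i.
  rewrite corootE linearZ /=; apply: mulr_gt0 => //.
  by apply: divr_gt0; rewrite ?ltr0n // dual_dot_gt0 ?simple_neq0.
have Pj := sr_sub Ha j; have Pb' := root_refl Pj Pb.
have [m em] : pos (b \o sr j)%VF.
  apply: pos_refl_simple => // [|e]; last by apply: nsimple; exists j.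
  by apply/natcombE; exists n.
have em' : (b \o sr j)%VF = \sum_i (m i)%:R *: a i.
  by rewrite em; apply: eq_bigr => i _; rewrite scaler_nat.
set k := b _ in kj.
have e : \sum_i ((m i)%:R + if i == j then k else 0) *: a i = \sum_i (n i)%:R *: a i.
  under eq_bigr do rewrite scalerDl; rewrite big_split /= -en -em' comp_refl -/k.
  rewrite (bigD1 j) //= eqxx big1 ?addr0 ?subrK // => i /negPf ->.
  by rewrite scale0r.
have {}e := simple_sumB e.
have [s es] : exists s, refl dot (b \o sr j)%VF = word s.
  apply: (IH _ m) => //; apply: leq_trans leN.
  rewrite (bigD1 j) //= [X in (_ < X)%N](bigD1 j) //= -addSn leq_add //.
    by rewrite -(ltr_nat R) -(e j) eqxx ltrDl.
  by apply: leq_sum => i /negPf ij; rewrite -(ler_nat R) -(e i) ij addr0.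
exists (j :: rcons s j); rewrite -cats1 -cat1s !word_cat !word1 -es.
rewrite comp_lfunA (refl_conj b (refl_isometric dot (simple_neq0 j)) (srK j)).
by rewrite -comp_lfunA srK comp_lfun1r.
Qed.

Lemma weylP w : W w <-> exists s, word s = w.
Proof.
split=> [[s Ps ->]|[s <-]]; last exact: weyl_word.
elim: s Ps => [|b s IH] Ps /=; first by exists [::].
have [|s1 <-] := IH; first by move=> b' b's; apply: Ps; rewrite inE b's orbT.
have [s2 ->] : exists s2, refl dot b = word s2.
  by apply: weyl_refl_word; apply: Ps; rewrite mem_head.
by exists (s2 ++ s1); rewrite word_cat.
Qed.

Lemma weyl_inv w : W w -> W (w^-1)%VF.
Proof.
move=> Ww; have /weylP[s es] := Ww.
rewrite (@weyl_invE _ (word (rev s))) //; first exact: weyl_word.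
by rewrite -es word_Krev.
Qed.

Lemma weyl_invK w : W w -> (w^-1^-1)%VF = w.
Proof. by move=> Ww; apply: weyl_invE; [exact: weyl_inv|exact: weylVK]. Qed.

Lemma weyl_invM w w' : W w -> W w' -> ((w \o w')^-1)%VF = (w'^-1 \o w^-1)%VF.
Proof.
move=> Ww Ww'; apply: weyl_invE; first exact: weyl_comp.
by rewrite -comp_lfunA (comp_lfunA w') weylKV // comp_lfun1l weylKV.
Qed.

Lemma weyl_compKV w w' : W w -> (w \o (w^-1 \o w'))%VF = w'.
Proof. by move=> Ww; rewrite comp_lfunA weylKV // comp_lfun1l. Qed.

Lemma weyl_compVK w w' : W w -> (w^-1 \o (w \o w'))%VF = w'.
Proof. by move=> Ww; rewrite comp_lfunA weylVK // comp_lfun1l. Qed.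

Lemma root_weyl w b : W w -> Phi b -> Phi (b \o w)%VF.
Proof.
move=> [s Ps ->]; elim: s b Ps => [|b' s IH] b Ps Pb /=; first by rewrite comp_lfun1r.
rewrite comp_lfunA; apply: IH; first by move=> c cs; apply: Ps; rewrite inE cs orbT.
by apply: root_refl => //; apply: Ps; rewrite mem_head.
Qed.

Lemma redexprP w : W w -> word (redexpr dot a w) = w /\ reduced dot a (redexpr dot a w).
Proof.
move=> /weylP[s0 e0]; pose P n := `[< exists2 s, word s = w & size s = n >].
have exP : exists n, P n by exists (size s0); apply/asboolP; exists s0.
case: (ex_minnP exP) => n /asboolP[s es sn] min.
rewrite /redexpr; case: xgetP => [s' _ //|/(_ s)/(_ (conj es _))[]] s' e'.
by rewrite sn; apply: min; apply/asboolP; exists s'; rewrite // e'.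
Qed.

Lemma word_redexpr w : W w -> word (redexpr dot a w) = w. Proof. by move/redexprP => []. Qed.

Lemma len_word s : (len (word s) <= size s)%N.
Proof. by have [e] := redexprP (weyl_word s); apply. Qed.

Lemma reducedP s : reduced dot a s <-> size s = len (word s).
Proof.
split=> [h|h s' e']; last by rewrite h -e' len_word.
apply/eqP; rewrite eqn_leq len_word andbT; apply: h.
by rewrite word_redexpr //; exact: weyl_word.
Qed.

Lemma redexpr_ex w : W w -> exists2 s, word s = w & size s = len w.
Proof. by move=> Ww; exists (redexpr dot a w) => //; exact: word_redexpr. Qed.

Lemma reduced_ex w : W w -> exists2 s, word s = w & reduced dot a s.
Proof. by move=> /redexprP[]; exists (redexpr dot a w). Qed.

Lemma len1 : len \1%VF = 0%N.
Proof. by apply/eqP; rewrite -leqn0; exact: (len_word [::]). Qed.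

Lemma len_eq0 w : W w -> len w = 0%N -> w = \1%VF.
Proof. by move=> /redexpr_ex[s <- <-]; case: s. Qed.

Lemma len_inv w : W w -> len (w^-1)%VF = len w.
Proof.
have le w' : W w' -> (len (w'^-1)%VF <= len w')%N.
  move=> Ww; have [s es <-] := redexpr_ex Ww.
  rewrite -size_rev (@weyl_invE _ (word (rev s))) ?len_word //.
  by rewrite -es word_Krev.
move=> Ww; apply/eqP; rewrite eqn_leq le //=.
by rewrite -{1}(weyl_invK Ww) le //; exact: weyl_inv.
Qed.

(** Feed the letters of s to b one at a time. The sign has to change at some letter i, and by
    [pos_refl_simple] the only positive root that s_i makes negative is a_i itself. *)
Lemma exchange b s : Phi b -> pos b -> pos (- (b \o word s)%VF) ->
  exists s1 i s2, s = s1 ++ i :: s2 /\ (b \o word s1)%VF = a i.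
Proof.
elim: s b => [|i s IH] b Pb pb /=.
  by rewrite comp_lfun1r => /(root_not_both Pb pb).
have [->|nb] := pselect (b = a i); first by exists [::], i, s; rewrite /= comp_lfun1r.
rewrite comp_lfunA => nbs; have [|||s1 [i' [s2 [-> e]]]] := IH (b \o sr i)%VF.
- by apply: root_refl => //; exact: sr_sub Ha _.
- exact: pos_refl_simple.
- exact: nbs.
by exists (i :: s1), i', s2; rewrite /= comp_lfunA.
Qed.

Lemma exchange_word j s : pos (- (a j \o word s)%VF) ->
  exists s1 i s2, s = s1 ++ i :: s2 /\ word (j :: s1) = word (rcons s1 i).
Proof.
move=> /(exchange (sr_sub Ha j) (pos_simple j))[s1 [i [s2 [-> e]]]].
exists s1, i, s2; split=> //; rewrite -cats1 word_cat word1 -e /=.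
by rewrite (refl_conj (a j) (weyl_isom (weyl_word s1)) (word_Krev s1)).
Qed.

Lemma simple_refl j : (a j \o sr j)%VF = - a j.
Proof.
by rewrite comp_refl coroot_pair ?simple_neq0 // scaler_nat mulr2n opprD addrA subrr add0r.
Qed.

Lemma sr_compK j w : (sr j \o (sr j \o w))%VF = w.
Proof. by rewrite comp_lfunA srK comp_lfun1l. Qed.

Lemma weyl_sr j : W (sr j). Proof. by apply: weyl_refl; exact: sr_sub Ha _. Qed.

Lemma weyl_srl j w : W w -> W (sr j \o w)%VF.
Proof. by move=> Ww; apply: weyl_comp => //; exact: weyl_sr. Qed.

(** [a j \o w] is w^-1 applied to a_j, so its sign detects left descents. The exchange property
    deletes a letter from a shortest word of w, which gives the upper bound on the length of s_j
    w. *)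
Lemma len_neg j w : W w -> pos (- (a j \o w)%VF) -> len w = (len (sr j \o w)%VF).+1.
Proof.
move=> Ww; have [s es ss] := redexpr_ex Ww; rewrite -es => /exchange_word[s1 [i [s2 [e1 e2]]]].
apply/eqP; rewrite eqn_leq; apply/andP; split.
  have [s' es' <-] := redexpr_ex (weyl_srl j (weyl_word s)).
  have -> : word s = word (j :: s') by rewrite /= es' sr_compK.
  exact: len_word.
rewrite [X in (_ < len X)%N]es -ss {2}e1 size_cat /= addnS ltnS -size_cat.
have -> : (sr j \o word s)%VF = word (s1 ++ s2); last exact: len_word.
rewrite e1 !word_cat comp_lfunA -[(sr j \o word s1)%VF]/(word (j :: s1)) e2.
by rewrite -cats1 word_cat word1 -comp_lfunA /= sr_compK.
Qed.

Lemma len_pos j w : W w -> pos (a j \o w)%VF -> len (sr j \o w)%VF = (len w).+1.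
Proof.
move=> Ww p; have n : pos (- (a j \o (sr j \o w))%VF).
  by rewrite comp_lfunA simple_refl comp_lfunNl opprK.
by rewrite (len_neg (weyl_srl j Ww) n) sr_compK.
Qed.

Lemma simple_root j : Phi (a j). Proof. exact: sr_sub Ha _. Qed.

Lemma simple_sign j w : W w -> pos (a j \o w)%VF \/ pos (- (a j \o w)%VF).
Proof. by move=> Ww; apply: root_sign; apply: root_weyl => //; exact: simple_root. Qed.

Lemma len_posr j w : W w -> pos (a j \o w^-1)%VF -> len (w \o sr j)%VF = (len w).+1.
Proof.
move=> Ww p; have Wj := weyl_sr j; rewrite -len_inv; last exact: weyl_comp.
rewrite weyl_invM // (weyl_invE Wj (srK j)) len_pos ?len_inv //; exact: weyl_inv.
Qed.

Lemma len_negr j w : W w -> pos (- (a j \o w^-1)%VF) -> len w = (len (w \o sr j)%VF).+1.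
Proof.
move=> Ww p; have Wj := weyl_sr j; rewrite -(len_inv (weyl_comp Ww Wj)).
rewrite weyl_invM // (weyl_invE Wj (srK j)) -len_neg ?len_inv //; exact: weyl_inv.
Qed.

Lemma reduced_cons j s : reduced dot a (j :: s) <-> reduced dot a s /\ pos (a j \o word s)%VF.
Proof.
have Ws := weyl_word s; split=> [/reducedP|[/reducedP ss p]]; last first.
  by apply/reducedP; rewrite /= len_pos // ss.
rewrite /= => e; have := len_word s => le.
case: (simple_sign j Ws) => [p|n]; last by have := len_neg Ws n; lia.
by split=> //; apply/reducedP; have := len_pos Ws p; lia.
Qed.

Lemma reduced_cat s s' : reduced dot a (s ++ s') <->
  [/\ reduced dot a s, reduced dot a s' &
      len (word s \o word s')%VF = (len (word s) + len (word s'))%N].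
Proof.
rewrite -word_cat; split=> [/reducedP|[/reducedP e1 /reducedP e2 e]]; last first.
  by apply/reducedP; rewrite size_cat e1 e2 e.
rewrite size_cat => e; have e0 := len_word s; have e1 := len_word s'.
have [s1 es1 l1] := redexpr_ex (weyl_word s); have [s2 es2 l2] := redexpr_ex (weyl_word s').
have := len_word (s1 ++ s2); rewrite word_cat es1 es2 -word_cat size_cat => le.
by split; try (apply/reducedP); lia.
Qed.

Lemma simple_fix1 w : W w -> (forall j, pos (a j \o w)%VF) -> w = \1%VF.
Proof.
move=> Ww p; apply: len_eq0 => //; have [es] := redexprP Ww.
rewrite /wlength; case: (redexpr _ _ _) es => // j s /= es /reduced_cons[_ pj].
have Pj := root_weyl (weyl_word s) (simple_root j).
have := p j; rewrite -es comp_lfunA simple_refl comp_lfunNl.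
by move=> /(root_not_both Pj pj).
Qed.

(** An element w is determined by the roots a_i w. The simple roots need not span the dual of E, so
    injectivity is not linear algebra: if w and w' agree on them, then w w'^-1 keeps every simple
    root positive and has length 0. *)
Lemma weyl_finite : finite_set W.
Proof.
have /finite_fsetP[X eX] := rs_finite HPhi.
have inX w i : W w -> (a i \o w)%VF \in X.
  move=> Ww; have : Phi (a i \o w)%VF by apply: root_weyl => //; exact: simple_root.
  by rewrite eX.
pose h w : {ffun 'I_r -> option X} := [ffun i => insub (a i \o w)%VF].
rewrite -(eq_finite_set (A := h @` W)) //; apply: inj_card_eq.
move=> w w' /set_mem Ww /set_mem Ww' /ffunP e.
have {}e i : (a i \o w)%VF = (a i \o w')%VF.
  have := e i; rewrite !ffunE !insubT ?inX // => h1 h2 [].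
  by [].
have : (w \o w'^-1)%VF = \1%VF.
  apply: simple_fix1; first by apply: weyl_comp => //; exact: weyl_inv.
  by move=> j; rewrite comp_lfunA e -comp_lfunA weylKV // comp_lfun1r; exact: pos_simple.
by move=> /(congr1 (fun u => u \o w')%VF); rewrite -comp_lfunA weylVK // comp_lfun1r comp_lfun1l.
Qed.

(** * The longest element *)

Local Notation w0 := (longest dot Phi a).

Lemma longestP : W w0 /\ forall w, W w -> (len w <= len w0)%N.
Proof.
rewrite /longest; case: xgetP => [w _ //|nex]; exfalso.
have /finite_seqP[X eX] := weyl_finite.
have WX w : W w -> w \in X by rewrite eX.
pose B := (\max_(w <- X) len w)%N.
pose P n := `[< exists2 w, W w & len w = n >].
have exP : exists n, P n by exists (len \1%VF); apply/asboolP; exists \1%VF => //; exact: weyl1.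
have leP n : P n -> (n <= B)%N.
  by move=> /asboolP[w /WX wX <-]; exact: (@leq_bigmax_seq _ X xpredT len w wX isT).
case: (ex_maxnP exP leP) => n /asboolP[w Ww <-] max.
by apply: (nex w); split=> // u Wu; apply: max; apply/asboolP; exists u.
Qed.

Lemma pos_sum_comp (n : 'I_r -> nat) w :
  (forall j, n j != 0%N -> pos (a j \o w)%VF) -> pos ((\sum_j a j *+ n j) \o w)%VF.
Proof.
move=> h; elim/big_rec: _ => [|j b _ IH]; first by rewrite comp_lfun0l; exact: pos0.
rewrite comp_lfunDl; apply: posD => //.
have [->|/h p] := eqVneq (n j) 0%N; first by rewrite mulr0n comp_lfun0l; exact: pos0.
elim: (n j) => [|k IHk]; first by rewrite mulr0n comp_lfun0l; exact: pos0.
by rewrite mulrS comp_lfunDl; apply: posD.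
Qed.

Lemma longest_weyl : W w0. Proof. by case: longestP. Qed.

Lemma longest_neg b : pos b -> pos (- (b \o w0)%VF).
Proof.
have [Ww0 max] := longestP; move=> [n ->]; rewrite -comp_lfunNr.
apply: pos_sum_comp => j _; rewrite comp_lfunNr.
case: (simple_sign j Ww0) => // /(len_pos Ww0) e.
by have := max _ (weyl_srl j Ww0); rewrite e ltnn.
Qed.

(** w_0 makes all positive roots negative, so each letter of a reduced word that lengthens w
    shortens w w_0. *)
Lemma len_mul_longest w : W w -> (len (w \o w0)%VF + len w)%N = len w0.
Proof.
have Ww0 := longest_weyl; move=> /reduced_ex[s <-].
elim: s => [|j s IH]; first by rewrite /= comp_lfun1l len1 addn0.
move=> /reduced_cons[/IH{}IH p]; have Ws := weyl_word s.
rewrite /= len_pos // -comp_lfunA.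
have := longest_neg p; rewrite -comp_lfunA => /(len_neg (weyl_comp Ws Ww0)); lia.
Qed.

Lemma longest_invol : (w0 \o w0)%VF = \1%VF.
Proof.
have Ww0 := longest_weyl; apply: len_eq0; first exact: weyl_comp.
by have := len_mul_longest Ww0; lia.
Qed.

Lemma longest_inv : (w0^-1)%VF = w0.
Proof. exact: weyl_invE longest_weyl longest_invol. Qed.

Lemma len_longest_mul w : W w -> (len (w0 \o w)%VF + len w)%N = len w0.
Proof.
have Ww0 := longest_weyl; move=> Ww; rewrite -len_inv; last exact: weyl_comp.
by rewrite weyl_invM // longest_inv -(len_inv Ww) len_mul_longest //; exact: weyl_inv.
Qed.

Lemma len_sr j : len (sr j) = 1%N.
Proof.
have := len_pos weyl1 (j := j); rewrite !comp_lfun1r len1; apply; exact: pos_simple.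
Qed.

(** The two length formulas give w_0 s_j w_0 length 1, so it is some s_j'. It is also the reflection
    in the positive root b = - a_j w_0, which it negates; but a_j' is the only positive root that
    s_j' makes negative. *)
Lemma longest_conj j : exists j', (w0 \o (sr j \o w0))%VF = sr j' /\ a j' = - (a j \o w0)%VF.
Proof.
have Ww0 := longest_weyl; have Wj := weyl_sr j.
have Wx : W (w0 \o (sr j \o w0))%VF by apply: weyl_comp => //; exact: weyl_comp.
have l1 : len (w0 \o (sr j \o w0))%VF = 1%N.
  have := len_longest_mul (weyl_comp Wj Ww0); have := len_mul_longest Wj; rewrite len_sr; lia.
have [s es] := redexpr_ex Wx; rewrite l1; case: s es => // j' [] // es _.
rewrite word1 in es; exists j'; split=> //.
pose b := - (a j \o w0)%VF.
have Pb : Phi b by apply: rootN; apply: root_weyl => //; exact: simple_root.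
have pb : pos b by apply: longest_neg; exact: pos_simple.
have rb : refl dot b = sr j'.
  rewrite es reflN -(refl_conj (a j) (weyl_isom Ww0) longest_invol).
  by rewrite comp_lfunA longest_invol comp_lfun1l.
apply: contrapT => nb; have nb' : b <> a j' by move=> e; apply: nb; rewrite -e.
have := pos_refl_simple Pb pb nb'; rewrite -rb comp_refl coroot_pair ?root_neq0 //.
rewrite scaler_nat mulr2n opprD addrA subrr add0r.
exact: root_not_both Pb pb.
Qed.

(** * Stabilizers of dominant points and minimal coset representatives *)

Section Dominant.
Variable c : E.
Hypothesis dom : forall j, 0 <= a j c.
Local Notation Wc := (weyl_stab dot Phi c).
Local Notation mr := (min_reps dot Phi a c).

Lemma pos_dom b : pos b -> 0 <= b c.
Proof.
move=> /natcombE[n ->]; rewrite sum_lfunE; apply: sumr_ge0 => i _.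
by rewrite scale_lfunE; apply: mulr_ge0.
Qed.

Lemma sr_fix j y : a j y = 0 -> sr j y = y.
Proof. by move=> e; rewrite reflE e scale0r subr0. Qed.

Lemma simple_sr j y : a j (sr j y) = - a j y.
Proof. by rewrite -comp_lfunE simple_refl opp_lfunE. Qed.

(** This makes W_c a standard parabolic subgroup. For a first letter j, reducedness gives a_j(word s
    c) >= 0, while word s c = s_j c gives a_j(word s c) = - a_j(c) <= 0; so a_j(c) = 0, the letter
    may be dropped, and the argument repeats. *)
Lemma stab_word s : reduced dot a s -> word s c = c -> forall j, j \in s -> a j c = 0.
Proof.
elim: s => // j s IH /reduced_cons[rs p] /=; rewrite comp_lfunE => e.
have e' : word s c = sr j c.
  by rewrite -[RHS](congr1 (sr j) e) -[sr j (sr j _)]comp_lfunE srK id_lfunE.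
have j0 : a j c = 0.
  apply/eqP; rewrite eq_le dom andbT -oppr_ge0 -simple_sr -e' -comp_lfunE.
  exact: pos_dom.
move=> j'; rewrite inE => /orP[/eqP-> //|]; apply: IH => //.
by rewrite e' sr_fix.
Qed.

Lemma stab1 : Wc \1%VF. Proof. by split; [exact: weyl1|rewrite /= id_lfunE]. Qed.

Lemma stab_comp w w' : Wc w -> Wc w' -> Wc (w \o w')%VF.
Proof.
move=> [Ww /= e] [Ww' /= e']; split; first exact: weyl_comp.
by rewrite /= comp_lfunE e' e.
Qed.

Lemma stab_inv w : Wc w -> Wc (w^-1)%VF.
Proof.
move=> [Ww /= e]; split; first exact: weyl_inv.
by rewrite /= -[in LHS]e -comp_lfunE weylVK // id_lfunE.
Qed.

Lemma min_reps_pos w j : mr w -> a j c = 0 -> pos (a j \o w^-1)%VF.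
Proof.
move=> [Ww min] j0; have Wj := weyl_sr j.
have le : (len w <= len (w \o sr j)%VF)%N by apply: min; split=> //=; exact: sr_fix.
case: (simple_sign j (weyl_inv Ww)) => // /(len_negr Ww); lia.
Qed.

(** After inverting, a reduced word of u^-1 is prepended to w^-1 letter by letter. The positive root
    met at each letter vanishes at c, so by dominance it involves only simple roots vanishing at c,
    and w^-1 keeps these positive. *)
Lemma min_reps_len w u : mr w -> Wc u -> len (w \o u)%VF = (len w + len u)%N.
Proof.
move=> mw Wu; have [Ww _] := mw; have Wwi := weyl_inv Ww; have [Wu' _] := Wu.
have [Wui] := stab_inv Wu => /=.
rewrite -(len_inv (weyl_comp Ww Wu')) weyl_invM // -(len_inv Wu') -(len_inv Ww).
have [s <-] := reduced_ex Wui.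
elim: s => [|j s IH]; first by rewrite /= comp_lfun1l len1 addn0.
move=> /[dup] rs /reduced_cons[rs' p] e.
have j0 : a j c = 0 by apply: (stab_word rs e); rewrite mem_head.
have es : word s c = c.
  by have := congr1 (sr j) e; rewrite /= comp_lfunE reflK ?simple_neq0 // sr_fix.
have Ws := weyl_word s; rewrite /= -comp_lfunA !len_pos //.
- by rewrite IH // addnS.
- exact: weyl_comp.
rewrite comp_lfunA; have : (a j \o word s)%VF c = 0 by rewrite comp_lfunE es.
have [n ->] := p => e0; apply: pos_sum_comp => i ni; apply: min_reps_pos => //.
move: e0; rewrite sum_lfunE => /eqP; rewrite psumr_eq0.
  move=> /allP/(_ i (mem_index_enum _)) /=; rewrite -scaler_nat scale_lfunE.
  by rewrite mulf_eq0 pnatr_eq0 (negPf ni) => /eqP.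
by move=> k _; rewrite -scaler_nat scale_lfunE; apply: mulr_ge0.
Qed.

Lemma min_reps_ex v : W v -> exists w u, [/\ mr w, Wc u & v = (w \o u)%VF].
Proof.
move=> Wv; pose P n := `[< exists2 u, Wc u & len (v \o u)%VF = n >].
have exP : exists n, P n by exists (len (v \o \1)%VF); apply/asboolP; exists \1%VF => //; exact: stab1.
case: (ex_minnP exP) => n /asboolP[u Wu <-] min.
have [Wu' _] := Wu; exists (v \o u)%VF, (u^-1)%VF; split; last 1 first.
- by rewrite -comp_lfunA weylKV // comp_lfun1r.
- split; first exact: weyl_comp.
  move=> u' Wu''; apply: min; apply/asboolP; exists (u \o u')%VF; first exact: stab_comp.
  by rewrite comp_lfunA.
exact: stab_inv.
Qed.

(** With u = w^-1 w', additivity gives both l(w') = l(w) + l(u) and l(w) = l(w') + l(u), so l(u) =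
    0. *)
Lemma min_reps_inj w w' : mr w -> mr w' -> w c = w' c -> w = w'.
Proof.
move=> mw mw' e; have [[Ww _] [Ww' _]] := (mw, mw').
have Wu : Wc (w^-1 \o w')%VF.
  split; first by apply: weyl_comp => //; exact: weyl_inv.
  by rewrite /= comp_lfunE -e -comp_lfunE weylVK // id_lfunE.
have := min_reps_len mw Wu; rewrite weyl_compKV // => l1.
have := min_reps_len mw' (stab_inv Wu).
rewrite weyl_invM ?weyl_invK //; last exact: weyl_inv.
rewrite weyl_compKV // => l2.
have : (w^-1 \o w')%VF = \1%VF by apply: len_eq0; [case: Wu|lia].
by move=> /(congr1 (fun u => w \o u)%VF); rewrite weyl_compKV // comp_lfun1r.
Qed.

Lemma weyl_pos j w : W w -> 0 < a j (w c) -> pos (a j \o w)%VF.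
Proof.
move=> Ww gt; case: (simple_sign j Ww) => // /pos_dom.
by rewrite opp_lfunE comp_lfunE oppr_ge0 leNgt gt.
Qed.

(** The step of the recursion: going from wc towards the antidominant point stays among the minimal
    representatives and adds exactly 1 to the length. *)
Lemma min_reps_up w j : mr w -> 0 < a j (w c) ->
  mr (sr j \o w)%VF /\ len (sr j \o w)%VF = (len w).+1.
Proof.
move=> mw gt; have [Ww min] := mw; have l1 := len_pos Ww (weyl_pos Ww gt).
split=> //; split; first exact: weyl_srl.
move=> u Wu; have [Wu' /= ec] := Wu; rewrite l1 -comp_lfunA len_pos.
- by rewrite ltnS; apply: min.
- exact: weyl_comp.
by apply: weyl_pos; [exact: weyl_comp|rewrite comp_lfunE ec].
Qed.

Lemma dominant_fix w : W w -> (forall j, 0 <= a j (w c)) -> w c = c.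
Proof.
move=> /reduced_ex[s <-].
elim: s => [|j s IH]; first by rewrite /= id_lfunE.
move=> /reduced_cons[rs p] /=; rewrite comp_lfunE => d.
have j0 : a j (word s c) = 0.
  apply/eqP; rewrite eq_le -{1}oppr_ge0 -simple_sr d /= -comp_lfunE; exact: pos_dom.
by rewrite sr_fix // in d *; exact: IH.
Qed.

(** w_0 sends simple roots to negatives of simple roots, so w_0 wc is dominant, and c is the only
    dominant point of its orbit. *)
Lemma antidominant_fix w : W w -> (forall j, a j (w c) <= 0) -> w0 (w c) = c.
Proof.
move=> Ww h; rewrite -comp_lfunE; apply: dominant_fix; first exact: weyl_comp longest_weyl Ww.
move=> j; rewrite comp_lfunE; have [j' [_ e]] := longest_conj j.
by rewrite -comp_lfunE -[(a j \o _)%VF]opprK -e opp_lfunE oppr_ge0.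
Qed.

(** Climb from w' by [min_reps_up]. The lengths increase and are bounded, so the climb ends at an
    antidominant point, and the orbit has only one. *)
Lemma min_reps_top_len w w' : mr w -> mr w' -> (forall j, a j (w c) <= 0) ->
  w' c <> w c -> (len w' < len w)%N.
Proof.
move=> mw; have [n] := ubnP (len w0 - len w')%N; elim: n w' => // n IH w' ltn mw' h ne.
have [[Ww _] [Ww' _]] := (mw, mw').
have [j gt] : exists j, 0 < a j (w' c).
  apply: contrapT => nex; apply: ne.
  have h' j : a j (w' c) <= 0 by rewrite leNgt; apply/negP => gt; apply: nex; exists j.
  have e := antidominant_fix Ww h; have e' := antidominant_fix Ww' h'.
  have := congr1 (fun y => w0 y) (etrans e' (esym e)).
  by rewrite -!(comp_lfunE w0 w0) longest_invol !id_lfunE.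
have [mw'' l] := min_reps_up mw' gt.
have [e|ne'] := pselect ((sr j \o w')%VF c = w c); first by rewrite -(min_reps_inj mw'' mw e) l.
have [_ max] := longestP; have := max _ (mw''.1); rewrite l => lt.
have := IH _ _ mw'' h ne'; rewrite l; move: ltn; rewrite ltnS; lia.
Qed.

End Dominant.

(** * Alternating words and Matsumoto's theorem *)

Fixpoint alt (n : nat) (i j : 'I_r) : seq 'I_r :=
  if n is n'.+1 then i :: alt n' j i else [::].

Lemma size_alt n i j : size (alt n i j) = n.
Proof. by elim: n i j => //= n IH i j; rewrite IH. Qed.

Lemma alt_cat_prefix n i j x s1 l s2 : (size s1 < n)%N ->
  alt n i j ++ x = s1 ++ l :: s2 ->
  s1 = alt (size s1) i j /\ rcons s1 l = alt (size s1).+1 i j.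
Proof.
elim: s1 n i j => [|k s1 IH] [|n] i j //=; first by move=> _ [<-].
by rewrite ltnS => lt [<- /(IH _ _ _ lt)[es el]]; split; [rewrite {1}es|rewrite el].
Qed.

Lemma alt_cat_suffix n i j x s1 s2 : (n <= size s1)%N ->
  alt n i j ++ x = s1 ++ s2 -> exists s1', s1 = alt n i j ++ s1'.
Proof.
elim: n i j s1 => [|n IH] i j [|k s1] //=; try by exists [::].
  by exists (k :: s1).
by rewrite ltnS => lt [<- /(IH _ _ _ lt)[s1' ->]]; exists s1'.
Qed.

Lemma iter_comp n (u w : 'End(E)) : iter n (comp_lfun u) w = (iter n (comp_lfun u) \1 \o w)%VF.
Proof. by elim: n => /= [|n ->]; rewrite ?comp_lfun1l // comp_lfunA. Qed.

(** Cancelling from the middle, s_i s_j s_i ... = (s_i s_j)^n s_j s_i s_j ... with n letters in each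
    alternating word. So the two words agree exactly when (s_i s_j)^n = 1. *)
Lemma word_alt n i j :
  word (alt n i j) = iter n (comp_lfun (sr i \o sr j)) (word (alt n j i)).
Proof.
elim: n i j => //= n IH i j; rewrite IH -iterS iterSr.
have -> : ((sr i \o sr j) \o (sr j \o word (alt n i j)))%VF = (sr i \o word (alt n i j))%VF.
  by rewrite -comp_lfunA sr_compK.
elim: n {IH} (word _) => //= n IH w; rewrite -IH.
by rewrite -!comp_lfunA.
Qed.

Lemma word_alt_eq n i j : word (alt n i j) = word (alt n j i) <->
  iter n (comp_lfun (sr i \o sr j)) \1%VF = \1%VF.
Proof.
rewrite word_alt iter_comp; split=> [e|->]; last by rewrite comp_lfun1l.
by have := congr1 (fun u => u \o word (rev (alt n j i)))%VF e;
  rewrite -comp_lfunA word_Krev comp_lfun1r.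
Qed.

(* If w has both descents i and j, exchanging lengthens an alternating prefix of
   a reduced word of w until it reaches the order of s_i s_j. *)
Lemma alt_reduced w i j k : W w ->
  pos (- (a i \o w)%VF) -> pos (- (a j \o w)%VF) ->
  (forall p, (0 < p < k.+1)%N -> iter p (comp_lfun (sr i \o sr j)) \1%VF <> \1%VF) ->
  forall i' j', (i', j') = (i, j) \/ (i', j') = (j, i) ->
  exists2 x, word (alt k.+1 i' j' ++ x) = w & reduced dot a (alt k.+1 i' j' ++ x).
Proof.
move=> Ww ni nj; elim: k => [|k IH] np i' j' ij.
  have n' : pos (- (a i' \o w)%VF) by case: ij => -[-> _].
  have l := len_neg Ww n'; have [x ex sx] := redexpr_ex (weyl_srl i' Ww).
  exists x; first by rewrite /= ex sr_compK.
  by apply/reducedP; rewrite /= ex sr_compK sx l.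
have n' : pos (- (a i' \o w)%VF) by case: ij => -[-> _].
have [||x ex rx] := IH _ j' i'.
- by move=> p lt; apply: np; lia.
- by case: ij => -[-> ->]; [right|left].
rewrite -ex in n'; have [s1 [l [s2 [es e1]]]] := exchange_word n'.
(* A letter deleted inside the alternating prefix would equate two alternating words of at most k+1
   letters, which [np] excludes. The deleted letter therefore lies beyond the prefix, and the letter
   put in front extends the prefix by one. *)
have [lt|ge] := ltnP (size s1) k.+1.
  have [es1 es1l] := alt_cat_prefix lt es; rewrite es1l in e1.
  have : word (alt (size s1).+1 i' j') = word (alt (size s1).+1 j' i') by rewrite -e1 /= -es1.
  by case: ij => -[-> ->]; [|move/esym]; move/word_alt_eq/np; case; lia.
have [s1' es1] := alt_cat_suffix ge es.
have e : word (alt k.+2 i' j' ++ (s1' ++ s2)) = w.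
  rewrite -ex es -cat_rcons !word_cat -e1 es1 -!word_cat /= -catA; congr (_ \o _)%VF.
exists (s1' ++ s2) => //; apply/reducedP; rewrite e -ex; move/reducedP: rx => <-.
by rewrite es !size_cat es1 /= !size_cat !size_alt; lia.
Qed.

Lemma reduced_le s : reduced dot a s -> (size s <= len (word s))%N.
Proof. by move=> /reducedP ->. Qed.

(** If no power of s_i s_j were 1, w would have a reduced word with an alternating prefix of l(w) +
    1 letters. *)
Lemma is_order_ex w i j : W w ->
  pos (- (a i \o w)%VF) -> pos (- (a j \o w)%VF) -> exists m, is_order (sr i \o sr j)%VF m.
Proof.
move=> Ww ni nj; pose u := (sr i \o sr j)%VF.
pose P p := (0 < p)%N && `[< iter p (comp_lfun u) \1%VF = \1%VF >].
have exP : exists p, P p.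
  apply: contrapT => nex.
  have [p lt e|x ex] := @alt_reduced w i j (len w) Ww ni nj _ i j (or_introl erefl).
    by apply: nex; exists p; apply/andP; split; [case/andP: lt|apply/asboolP].
  by move/reduced_le; rewrite ex size_cat size_alt; lia.
case: (ex_minnP exP) => m /andP[m0 /asboolP e] min; exists m; split=> // k /andP[k0 km] e'.
by have := min k; rewrite /P k0 => /(_ (asboolT e')); lia.
Qed.

(** Induction on the length. If the first letters i and j differ, both are descents of w, so w has
    reduced words starting with either alternating word of m letters and sharing one tail. Each
    given word is compared with the one having the same first letter, by induction, and the braid
    relation links these two. *)
Lemma matsumoto (H : pzRingType) (T : 'I_r -> H) :
  (forall i j m, i != j -> is_order (sr i \o sr j)%VF m ->
    \prod_(k <- iota 0 m) T (if odd k then j else i) =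
    \prod_(k <- iota 0 m) T (if odd k then i else j)) ->
  forall s s', reduced dot a s -> reduced dot a s' -> word s = word s' ->
  \prod_(k <- s) T k = \prod_(k <- s') T k.
Proof.
move=> braid.
have altE m i j : \prod_(k <- iota 0 m) T (if odd k then j else i) = \prod_(k <- alt m i j) T k.
  elim: m i j => [|m IH] i j /=; first by rewrite !big_nil.
  rewrite !big_cons -IH -add1n iotaDl big_map; congr (_ * _).
  by apply: eq_bigr => k _; rewrite add1n /=; case: (odd k).
move=> s; have [n] := ubnP (size s); elim: n s => // n IH [|i u] lt s' rs rs' e.
  have := reducedP s'; move=> [/(_ rs') + _]; rewrite -e /= len1.
  by move/size0nil => ->.
have [ru pi] := (reduced_cons i u).1 rs.
have Wu := weyl_word u; have Ww : W (word (i :: u)) by exact: weyl_word.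
case: s' rs' e => [|j v] rs' e.
  by have := (reducedP (i :: u)).1 rs; rewrite e /= len1.
have [rv pj] := (reduced_cons j v).1 rs'.
have ni : pos (- (a i \o word (i :: u))%VF).
  by rewrite /= comp_lfunA simple_refl comp_lfunNl opprK.
have nj : pos (- (a j \o word (i :: u))%VF).
  by rewrite e /= comp_lfunA simple_refl comp_lfunNl opprK.
rewrite !big_cons; rewrite /= ltnS in lt.
have sv : size v = size u.
  by have := (reducedP _).1 rs'; rewrite -e -((reducedP _).1 rs) => -[].
have canc k x y : word (k :: x) = word (k :: y) -> word x = word y.
  by move=> /= /(congr1 (fun z => sr k \o z)%VF); rewrite !sr_compK.
have [eij|ij] := eqVneq i j.
  by rewrite -eij in e *; congr (_ * _); apply: IH => //; exact: canc e.
have [m om] := is_order_ex Ww ni nj; have [m0 e1 np] := om.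
have [m' em] : exists m', m = m'.+1 by exists m.-1; lia.
rewrite em in np.
have [x ex rx] := alt_reduced Ww ni nj np (or_introl erefl).
have [y ey ry] := alt_reduced Ww ni nj np (or_intror erefl).
have eij : word (alt m i j) = word (alt m j i) by apply/word_alt_eq.
have ex' : word (alt m'.+1 j i ++ x) = word (i :: u).
  by rewrite -ex !word_cat -em eij.
have rx' : reduced dot a (alt m'.+1 j i ++ x).
  apply/reducedP; rewrite ex' -ex; have := (reducedP _).1 rx.
  by rewrite !size_cat !size_alt.
have [rx1 _] := (reduced_cons _ _).1 rx; have [rx1' _] := (reduced_cons _ _).1 rx'.
have -> : \prod_(k <- u) T k = \prod_(k <- alt m' j i ++ x) T k.
  by apply: IH => //; apply: (canc i); rewrite -ex.
have -> : \prod_(k <- v) T k = \prod_(k <- alt m' i j ++ x) T k.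
  by apply: IH => //; rewrite ?sv //; apply: (canc j); rewrite -e -ex'.
have bc k z : T k * \prod_(l <- z) T l = \prod_(l <- k :: z) T l by rewrite big_cons.
rewrite !bc -!cat_cons -[i :: alt _ _ _]/(alt m'.+1 i j).
rewrite -[j :: alt _ _ _]/(alt m'.+1 j i) -em !big_cat /= -!altE.
by rewrite (braid i j m).
Qed.

(** * The extended affine Hecke algebra and its representations *)

Section HeckeAlgebra.
Variables (F : fieldType) (t : dual -> F) (L : set E).
Hypotheses (Ht : weyl_invariant dot Phi t) (HL : admissible_lattice dot Phi L).
Local Notation A := (gralg F E).
Local Notation H := (hecke dot a t L).
Local Notation T := (heckeT dot a t L).
Local Notation Tw := (heckeTw dot a t L).
Local Notation ts j := (t (a j)).
Local Notation ks j := (t (a j) - (t (a j))^-1).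
Local Notation co j := (coroot dot (a j)).
Local Notation nabla := (nabla dot a).
Local Notation hg := (hecke_gralg dot a t L).

Lemma t_neq0 j : ts j != 0. Proof. by case: Ht => h _; apply: h; exact: simple_root. Qed.

Lemma smallest_subgroup (S : set E) : is_subgroup (smallest (@is_subgroup R E) S).
Proof.
split; first by move=> B [[]].
by move=> x y hx hy B hB; have [[_ SB] _] := hB; apply: SB; [apply: hx|apply: hy].
Qed.

Lemma lattice_subgroup : is_subgroup L.
Proof. by have [s ->] := al_fg HL; exact: smallest_subgroup. Qed.

Lemma lattice_coroot b : Phi b -> L (coroot dot b).
Proof.
move=> Pb; apply: (al_coroot HL); apply: sub_gen_smallest; exists b => //.
Qed.

Lemma subgroupMz (S : set E) x (m : int) : is_subgroup S -> S x -> S (x *~ m).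
Proof.
move=> Sgp Sx; have nat n : S (x *+ n).
  by elim: n => [|n IH]; [case: Sgp|rewrite mulrS; exact: subgroupD].
by case: m => n; [exact: nat|apply: subgroupN => //; exact: nat].
Qed.

Lemma lattice_int b y : Phi b -> L y -> exists m : int, b y = m%:~R.
Proof. by move=> Pb Ly; have /intrP[m ->] := al_int HL Pb Ly; exists m. Qed.

Lemma lattice_refl b y : Phi b -> L y -> L (refl dot b y).
Proof.
move=> Pb Ly; have [m e] := lattice_int Pb Ly; rewrite reflE e scaler_int.
apply: (proj2 lattice_subgroup) => //; apply: subgroupMz; first exact: lattice_subgroup.
exact: lattice_coroot.
Qed.

Lemma lattice_weyl w y : W w -> L y -> L (w y).
Proof.
move=> [s Ps ->] Ly; elim: s Ps => [|b s IH] Ps /=; first by rewrite id_lfunE.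
rewrite comp_lfunE; apply: lattice_refl; first by apply: Ps; rewrite mem_head.
by apply: IH => b' b's; apply: Ps; rewrite inE b's orbT.
Qed.

Lemma wact_linear w : linear (@wact R E F w).
Proof. exact: lin_ext_linear. Qed.

HB.instance Definition _ w :=
  GRing.isLinear.Build F A A _ (@wact R E F w) (wact_linear w).

Lemma wactZ w k (f : A) : wact w (k *: f) = k *: wact w f. Proof. exact: linearZ. Qed.
Lemma wactD w (f g : A) : wact w (f + g) = wact w f + wact w g. Proof. exact: linearD. Qed.
Lemma wactB w (f g : A) : wact w (f - g) = wact w f - wact w g. Proof. exact: linearB. Qed.

Lemma wactX w y : wact w (xpow F y) = xpow F (w y).
Proof. exact: lin_extX. Qed.

Lemma gralg_linear_ext (p q : A -> A) : linear p -> linear q ->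
  (forall y, p (xpow F y) = q (xpow F y)) -> p =1 q.
Proof. by move=> lp lq e f; apply: (@linear_gralg_eq _ _ _ setT p q). Qed.

Lemma wact_comp w w' (f : A) : wact w (wact w' f) = wact (w \o w')%VF f.
Proof.
apply: (@gralg_linear_ext (fun f => wact w (wact w' f)) (wact (w \o w')%VF)).
- by move=> k g1 g2; rewrite !wact_linear.
- exact: wact_linear.
by move=> y; rewrite !wactX comp_lfunE.
Qed.

Lemma wact1 (f : A) : wact \1%VF f = f.
Proof.
apply: (@gralg_linear_ext (wact \1%VF) id) => //; first exact: wact_linear.
by move=> y; rewrite wactX id_lfunE.
Qed.

Lemma mull_linear (g : A) : linear (fun f : A => g * f).
Proof. by move=> k f1 f2; rewrite mulrDr scalerAr. Qed.

Lemma mulr_linear (g : A) : linear (fun f : A => f * g).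
Proof. by move=> k f1 f2; rewrite mulrDl scalerAl. Qed.

Lemma wactM w (f g : A) : wact w (f * g) = wact w f * wact w g.
Proof.
apply: (@gralg_linear_ext (fun f => wact w (f * g)) (fun f => wact w f * wact w g)).
- by move=> k f1 f2; rewrite mulr_linear wact_linear.
- by move=> k f1 f2; rewrite wact_linear mulr_linear.
move=> y; apply: (@gralg_linear_ext (fun g => wact w (_ * g)) (fun g => wact w _ * wact w g)).
- by move=> k f1 f2; rewrite mull_linear wact_linear.
- by move=> k f1 f2; rewrite wact_linear mull_linear.
by move=> z; rewrite -xpowD !wactX -xpowD linearD.
Qed.

Lemma wact_one w : wact w (1 : A) = 1.
Proof. by rewrite -xpow0 wactX linear0. Qed.

Lemma wact_on w (f : A) : W w -> gralg_on L f -> gralg_on L (wact w f).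
Proof.
move=> Ww; move: f; apply: gralg_ind; first by rewrite linear0; exact: gralg_on0.
move=> k y f Ly IH; rewrite wact_linear wactX; apply: gralg_on_lin IH.
by apply: gralg_onX; exact: lattice_weyl.
Qed.

Lemma coroot_neq0 j : co j != 0.
Proof.
apply/eqP => e; have := coroot_pair dot (simple_neq0 j).
by rewrite e linear0 => /eqP; rewrite eq_sym pnatr_eq0.
Qed.

Lemma nabla_uniq j (f h : A) : h * (xpow F (co j) - 1) = wact (sr j) f - f -> nabla j f = h.
Proof. by move=> e; apply: gdivE => //; exact: coroot_neq0. Qed.

Lemma nabla_ex j (f : A) : gralg_on L f ->
  exists2 h : A, gralg_on L h & h * (xpow F (co j) - 1) = wact (sr j) f - f.
Proof.
move: f; apply: gralg_ind.
  by exists 0; [exact: gralg_on0|rewrite linear0 subrr mul0r].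
move=> k y f Ly [h Lh e]; have [m em] := lattice_int (simple_root j) Ly.
have Lco := lattice_coroot (simple_root j).
have [g Lg eg] := geom_div F (co j) (- m).
exists (k *: (xpow F y * g) + h).
  apply: gralg_on_lin => //; apply: gralg_onM lattice_subgroup _ _; first exact: gralg_onX.
  by move=> z /Lg[p _ <-]; apply: subgroupMz => //; exact: lattice_subgroup.
rewrite mulrDl e wact_linear wactX reflE em scaler_int -scalerAl -mulrA eg.
rewrite mulrBr mulr1 -xpowD mulrNz scalerBr opprD.
by rewrite !addrA; congr (_ + _); rewrite -!addrA; congr (_ + _); rewrite addrC.
Qed.

Lemma nabla_spec j (f : A) : gralg_on L f ->
  gralg_on L (nabla j f) /\ nabla j f * (xpow F (co j) - 1) = wact (sr j) f - f.
Proof. by move=> /(nabla_ex j)[h Lh e]; rewrite (nabla_uniq e). Qed.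

(** Restricted to F[L] because elsewhere the division may be impossible, and then [gdiv] returns
    0. *)
Lemma nabla_linear j k (f g : A) : gralg_on L f -> gralg_on L g ->
  nabla j (k *: f + g) = k *: nabla j f + nabla j g.
Proof.
move=> /(nabla_spec j)[_ e1] /(nabla_spec j)[_ e2]; apply: nabla_uniq.
rewrite mulrDl -scalerAl e1 e2 wact_linear scalerBr opprD !addrA.
by congr (_ + _); rewrite -!addrA; congr (_ + _); rewrite addrC.
Qed.

Lemma nabla0 j : nabla j (0 : A) = 0.
Proof. by apply: nabla_uniq; rewrite mul0r linear0 subrr. Qed.

Lemma nabla_invariant j (f : A) : wact (sr j) f = f -> nabla j f = 0.
Proof. by move=> e; apply: nabla_uniq; rewrite mul0r e subrr. Qed.

(** * The basis elements T_w of the Hecke algebra *)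

Lemma hscalerAl k (x y : H) : k *: (x * y) = (k *: x) * y.
Proof. exact: presented_scalerAl. Qed.

Lemma hscalerAr k (x y : H) : k *: (x * y) = x * (k *: y).
Proof. exact: presented_scalerAr. Qed.

Lemma hecke_gralg_linear : linear (hg : A -> H).
Proof. exact: lin_ext_linear. Qed.

HB.instance Definition _ := GRing.isLinear.Build F A H _ hg hecke_gralg_linear.

Lemma hecke_gralgX (l : L) : hg (xpow F (\val l)) = heckeX dot a t l.
Proof. by rewrite [LHS]lin_extX valK. Qed.

Lemma lattice_elt y : L y -> exists l : L, \val l = y.
Proof. by move=> Ly; exists (exist _ y (mem_set Ly)). Qed.

Lemma hecke_gralg_cross j (f : A) : gralg_on L f ->
  T j * hg f = hg (wact (sr j) f) * T j + ks j *: hg (nabla j f).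
Proof.
(* The induction has to carry membership in F[L] along, since [nabla] is linear only there. *)
suff : gralg_on L f -> gralg_on L f /\
    T j * hg f = hg (wact (sr j) f) * T j + ks j *: hg (nabla j f).
  by move=> h /h[].
move: f; apply: gralg_ind.
  split; first exact: gralg_on0.
  by rewrite (_ : wact (sr j) 0 = 0) ?linear0 // nabla0 !linear0 mulr0 mul0r ?scaler0 addr0.
move=> k y f Ly [Lf IH]; have Ly' : gralg_on L (xpow F y) by exact: gralg_onX.
split; first exact: gralg_on_lin.
rewrite (nabla_linear _ _ Ly' Lf) !wact_linear !hecke_gralg_linear mulrDr mulrDl IH.
have [l el] := lattice_elt Ly.
have [m em] := lattice_elt (lattice_refl (simple_root j) Ly).
rewrite wactX -em -el !hecke_gralgX -hscalerAr -hscalerAl.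
have := @hecke_cross R E dot r a F t L j l m; rewrite em el => /(_ erefl).
move=> /(canRL (subrK _)) ->.
rewrite !scalerDr !scalerA (mulrC k) [X in X + _ = _]addrC -!addrA; congr (_ + _).
exact: addrCA.
Qed.

Lemma hecke_sqr j : T j * T j = 1 + ks j *: T j.
Proof.
have := hecke_quad dot a t L j.
rewrite mulrDr !mulrBl -!hscalerAl -!hscalerAr !mul1r mulr1 scalerA mulfV ?t_neq0 //.
rewrite scale1r => /eqP; rewrite addrA subr_eq0 => /eqP <-.
by rewrite scalerBl -[RHS]addrA [X in _ = _ + X]addrCA subrr addr0 subrK.
Qed.

Definition Tinv j : H := T j - ks j *: (1 : H).

Lemma Tinvr j : T j * Tinv j = 1.
Proof. by rewrite mulrBr hecke_sqr -hscalerAr mulr1 addrK. Qed.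

Lemma Tinvl j : Tinv j * T j = 1.
Proof. by rewrite mulrBl hecke_sqr -hscalerAl mul1r addrK. Qed.

Lemma hecke_invE (h h' : H) : h * h' = 1 -> h' * h = 1 -> hecke_inv h = h'.
Proof.
move=> e e'; rewrite /hecke_inv; case: xgetP => [g _ /= [eg _]|/(_ h')[]//].
by rewrite -[g]mul1r -e' -mulrA eg mulr1.
Qed.

Definition hprod s : H := \prod_(j <- s) T j.

Lemma hprod_inv s : exists h, hprod s * h = 1 /\ h * hprod s = 1.
Proof.
elim: s => [|j s [h [e e']]]; first by exists 1; rewrite /hprod big_nil mulr1.
exists (h * Tinv j); rewrite /hprod big_cons -/(hprod s); split.
  by rewrite -mulrA (mulrA (hprod s)) e mul1r Tinvr.
by rewrite -mulrA (mulrA (Tinv j)) Tinvl mul1r.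
Qed.

Lemma hprod_cat s s' : hprod (s ++ s') = hprod s * hprod s'.
Proof. by rewrite /hprod big_cat. Qed.

Lemma Tw_word s : reduced dot a s -> Tw (word s) = hprod s.
Proof.
have [e rs'] := redexprP (weyl_word s) => rs.
apply: (matsumoto (H := H)) => //.
exact: hecke_braid.
Qed.

Lemma Tw_hprod w : Tw w = hprod (redexpr dot a w). Proof. by []. Qed.

Lemma Tw_comp w w' : W w -> W w' -> len (w \o w')%VF = (len w + len w')%N ->
  Tw (w \o w')%VF = Tw w * Tw w'.
Proof.
move=> /reduced_ex[s <- rs] /reduced_ex[s' <- rs'] e.
by rewrite (Tw_word rs) (Tw_word rs') -hprod_cat -word_cat Tw_word //; apply/reduced_cat.
Qed.

Lemma Tw_sr j : Tw (sr j) = T j.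
Proof.
rewrite -word1 Tw_word ?/hprod ?big_seq1 //; apply/reducedP; rewrite word1 len_sr //.
Qed.

Lemma Tw_inv w : hecke_inv (Tw w) * Tw w = 1 /\ Tw w * hecke_inv (Tw w) = 1.
Proof.
by have [h [e e']] := hprod_inv (redexpr dot a w); rewrite Tw_hprod (hecke_invE e e').
Qed.

Lemma mulT_Tw j w : W w ->
  T j * Tw w = Tw (sr j \o w)%VF + (if (len (sr j \o w)%VF < len w)%N then ks j else 0) *: Tw w.
Proof.
move=> Ww; case: (simple_sign j Ww) => [/(len_pos Ww) l|/(len_neg Ww) l].
  rewrite l ltnNge leqnSn scale0r addr0 -Tw_sr -Tw_comp //; first exact: weyl_sr.
  by rewrite l len_sr.
rewrite l ltnSn; have Wj := weyl_srl j Ww.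
have e : Tw w = T j * Tw (sr j \o w)%VF.
  by rewrite -Tw_sr -Tw_comp ?sr_compK ?l ?len_sr //; exact: weyl_sr.
by rewrite {1}e mulrA hecke_sqr mulrDl mul1r -hscalerAl -e.
Qed.

Lemma mulTw_T j w : W w ->
  Tw w * T j = Tw (w \o sr j)%VF + (if (len (w \o sr j)%VF < len w)%N then ks j else 0) *: Tw w.
Proof.
move=> Ww; have Wj := weyl_sr j; have Wwj := weyl_comp Ww Wj.
have [|] := simple_sign j (weyl_inv Ww).
  move/(len_posr Ww) => l.
  by rewrite l ltnNge leqnSn scale0r addr0 -Tw_sr -Tw_comp // l len_sr addn1.
move/(len_negr Ww) => l; rewrite l ltnSn.
have e : Tw w = Tw (w \o sr j)%VF * T j.
  by rewrite -Tw_sr -Tw_comp // -comp_lfunA srK comp_lfun1r // l len_sr addn1.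
by rewrite {1}e -mulrA hecke_sqr mulrDr mulr1 -hscalerAr -e.
Qed.

(** * The polynomial representation *)

Variable pi : H -> A -> A.
Hypothesis Hpi : polynomial_representation pi.

Lemma pi_on h (f : A) : gralg_on L f -> gralg_on L (pi h f).
Proof. exact: rep_stable (pr_rep Hpi) _ _. Qed.

Lemma piM h h' (f : A) : gralg_on L f -> pi (h * h') f = pi h (pi h' f).
Proof. exact: repM (pr_rep Hpi) _ _ _. Qed.

Lemma pi1 (f : A) : gralg_on L f -> pi 1 f = f.
Proof. exact: rep1 (pr_rep Hpi) _. Qed.

Lemma pi_linearl k h h' (f : A) : gralg_on L f -> pi (k *: h + h') f = k *: pi h f + pi h' f.
Proof. exact: rep_linearl (pr_rep Hpi) _ _ _ _. Qed.

Lemma pi_linear h k (f g : A) : gralg_on L f -> gralg_on L g ->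
  pi h (k *: f + g) = k *: pi h f + pi h g.
Proof. exact: rep_linear (pr_rep Hpi) _ _ _ _. Qed.

Lemma pi_T j (f : A) : gralg_on L f -> pi (T j) f = ts j *: wact (sr j) f + ks j *: nabla j f.
Proof. exact: pr_T Hpi _ _. Qed.

Lemma pi0l (f : A) : gralg_on L f -> pi 0 f = 0.
Proof.
move=> Lf; have := pi_linearl (-1) 0 0 Lf.
by rewrite scaler0 addr0 scaleN1r addNr.
Qed.

Lemma piDl h h' (f : A) : gralg_on L f -> pi (h + h') f = pi h f + pi h' f.
Proof. by move=> Lf; have := pi_linearl 1 h h' Lf; rewrite !scale1r. Qed.

Lemma piZl k h (f : A) : gralg_on L f -> pi (k *: h) f = k *: pi h f.
Proof. by move=> Lf; rewrite -[k *: h]addr0 pi_linearl // pi0l // addr0. Qed.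

Lemma piZ k h (f : A) : gralg_on L f -> pi h (k *: f) = k *: pi h f.
Proof.
move=> Lf; have p0 : pi h 0 = 0.
  have := pi_linear h (-1) (@gralg_on0 F E L) (@gralg_on0 F E L).
  by rewrite scaler0 addr0 scaleN1r addNr.
by rewrite -[k *: f]addr0 pi_linear ?p0 ?addr0 //; exact: gralg_on0.
Qed.

Lemma pi_sum (I : eqType) (s : seq I) (h : I -> H) (f : A) : gralg_on L f ->
  pi (\sum_(i <- s) h i) f = \sum_(i <- s) pi (h i) f.
Proof.
move=> Lf; elim: s => [|i s IH]; first by rewrite !big_nil pi0l.
by rewrite !big_cons piDl // IH.
Qed.

Lemma gralg_on1 : gralg_on L (1 : A).
Proof. by apply: gralg_onX; have [] := lattice_subgroup. Qed.

Lemma pi_hprod1 s : pi (hprod s) 1 = (\prod_(j <- s) ts j) *: 1.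
Proof.
have L1 := gralg_on1; elim: s => [|j s IH]; first by rewrite /hprod !big_nil pi1 // scale1r.
rewrite /hprod !big_cons -/(hprod s) (piM _ _ L1) IH (piZ _ _ L1) (pi_T _ L1) wact_one.
by rewrite (nabla_invariant (wact_one _)) scaler0 addr0 scalerA mulrC.
Qed.

(** * The scalars t(w) and the symmetrizers *)

Local Notation tw := (tw dot a t).

(** Independence of the reduced expression is inherited from T_w: in the polynomial representation
    T_j multiplies the vector 1 by t_j, so a product of generators multiplies it by the product of
    their parameters. *)
Lemma tw_word s : reduced dot a s -> tw (word s) = \prod_(j <- s) ts j.
Proof.
move=> rs; have : pi (Tw (word s)) 1 = pi (hprod s) 1 by rewrite Tw_word.
rewrite Tw_hprod !pi_hprod1 => /eqP; rewrite -subr_eq0 -scalerBl scaler_eq0 oner_eq0 orbF.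
by rewrite subr_eq0 => /eqP.
Qed.

Lemma tw_comp w w' : W w -> W w' -> len (w \o w')%VF = (len w + len w')%N ->
  tw (w \o w')%VF = tw w * tw w'.
Proof.
move=> /reduced_ex[s <- rs] /reduced_ex[s' <- rs'] e.
by rewrite (tw_word rs) (tw_word rs') -big_cat -word_cat tw_word //; apply/reduced_cat.
Qed.

Lemma tw_sr j : tw (sr j) = ts j.
Proof. by rewrite -word1 tw_word ?big_seq1 //; apply/reducedP; rewrite word1 len_sr. Qed.

Lemma tw_neq0 w : tw w != 0.
Proof. by rewrite prodf_seq_neq0; apply/allP => j _; rewrite t_neq0. Qed.

(** After reindexing by w |-> s_j w, the coefficient of T_w is t(s_j w), plus k_j t(w) when s_j w is
    shorter. It equals t_j t(w) in both cases; in the second, with t(w) = t_j t(s_j w), this reads 1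
    + (t_j - t_j^-1) t_j = t_j^2. It is used for both W and W_c. *)
Lemma T_symmetrizer (S : set 'End(E)) j : S `<=` W -> (forall w, S w -> S (sr j \o w)%VF) ->
  T j * symmetrizer dot a t L S = ts j *: symmetrizer dot a t L S.
Proof.
move=> SW Sj; have fS := sub_finite_set SW weyl_finite.
have inS w : w \in fset_set S -> S w by rewrite in_fset_set // => /set_mem.
pose dl w := if (len (sr j \o w)%VF < len w)%N then ks j else 0.
have re : \sum_(w \in S) tw w *: Tw (sr j \o w)%VF = \sum_(w \in S) tw (sr j \o w)%VF *: Tw w.
  rewrite [RHS](reindex_fsbig (fun w => sr j \o w)%VF S S).
    by apply: eq_fsbigr => w _; rewrite sr_compK.
  split=> //.
  - by move=> w w' _ _ /(congr1 (fun u => sr j \o u)%VF); rewrite !sr_compK.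
  - by move=> w Sw; exists (sr j \o w)%VF; [exact: Sj|rewrite sr_compK].
rewrite /symmetrizer fsbig_finite // mulr_sumr.
have -> : \sum_(w <- fset_set S) T j * (tw w *: Tw w) =
    \sum_(w <- fset_set S) (tw w *: Tw (sr j \o w)%VF + (dl w * tw w) *: Tw w).
  rewrite !big_seq; apply: eq_bigr => w /inS/SW Ww.
  by rewrite -hscalerAr mulT_Tw // scalerDr scalerA mulrC.
rewrite big_split /= -(fsbig_finite _ _ fS) re fsbig_finite // -big_split scaler_sumr /=.
rewrite !big_seq; apply: eq_bigr => w /inS/SW Ww; rewrite -scalerDl scalerA; congr (_ *: _).
rewrite /dl; case: (simple_sign j Ww) => [/(len_pos Ww) l|/(len_neg Ww) l].
  rewrite l ltnNge leqnSn mul0r addr0 tw_comp ?tw_sr ?l ?len_sr //; exact: weyl_sr.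
have Wj := weyl_srl j Ww.
have -> : tw w = ts j * tw (sr j \o w)%VF.
  by rewrite -tw_sr -tw_comp ?sr_compK ?l ?len_sr //; exact: weyl_sr.
rewrite l ltnSn mulrBl mulKf ?t_neq0 // addrC subrK mulrA //.
Qed.

Lemma symmetrizer_T j : symmetrizer dot a t L W * T j = ts j *: symmetrizer dot a t L W.
Proof.
have fS := weyl_finite.
have inS w : w \in fset_set W -> W w by rewrite in_fset_set // => /set_mem.
pose dl w := if (len (w \o sr j)%VF < len w)%N then ks j else 0.
have Wj := weyl_sr j.
have srK' w : ((w \o sr j) \o sr j)%VF = w by rewrite -comp_lfunA srK comp_lfun1r.
have re : \sum_(w \in W) tw w *: Tw (w \o sr j)%VF = \sum_(w \in W) tw (w \o sr j)%VF *: Tw w.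
  rewrite [RHS](reindex_fsbig (fun w => w \o sr j)%VF W W).
    by apply: eq_fsbigr => w _; rewrite srK'.
  split=> //.
  - by move=> w Ww; exact: weyl_comp.
  - by move=> w w' _ _ /(congr1 (fun u => u \o sr j)%VF); rewrite !srK'.
  - by move=> w Sw; exists (w \o sr j)%VF; [exact: weyl_comp|rewrite srK'].
rewrite /symmetrizer fsbig_finite // mulr_suml.
have -> : \sum_(w <- fset_set W) (tw w *: Tw w) * T j =
    \sum_(w <- fset_set W) (tw w *: Tw (w \o sr j)%VF + (dl w * tw w) *: Tw w).
  rewrite !big_seq; apply: eq_bigr => w /inS Ww.
  by rewrite -hscalerAl mulTw_T // scalerDr scalerA mulrC.
rewrite big_split /= -(fsbig_finite _ _ fS) re fsbig_finite // -big_split scaler_sumr /=.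
rewrite !big_seq; apply: eq_bigr => w /inS Ww; rewrite -scalerDl scalerA; congr (_ *: _).
have Wwj := weyl_comp Ww Wj.
rewrite /dl; have [/(len_posr Ww) l|/(len_negr Ww) l] := simple_sign j (weyl_inv Ww).
  by rewrite l ltnNge leqnSn mul0r addr0 tw_comp ?tw_sr ?l ?len_sr ?addn1 // mulrC.
have -> : tw w = tw (w \o sr j)%VF * ts j.
  by rewrite -tw_sr -tw_comp ?srK' ?l ?len_sr ?addn1.
by rewrite l ltnSn; have t0 := t_neq0 j; field.
Qed.

Local Notation oneW := (symmetrizer dot a t L W).

(** Applying the cross relation to s_j f, with nabla_j(s_j f) = - nabla_j f, writes f T_j with T_j
    on the left, where 1^+ turns it into t_j. What remains is exactly pi(T_j) f. *)
Lemma symmetrizer_gralg_T j (f : A) : gralg_on L f ->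
  oneW * hg f * T j = oneW * hg (pi (T j) f).
Proof.
move=> Lf; have Ls := wact_on (weyl_sr j) Lf.
have ss (g : A) : wact (sr j) (wact (sr j) g) = g by rewrite wact_comp srK wact1.
have nN : nabla j (wact (sr j) f) = - nabla j f.
  have [_ e] := nabla_spec j Lf; apply: nabla_uniq.
  by rewrite mulNr e ss opprB.
have := hecke_gralg_cross j Ls; rewrite ss nN => e.
have {}e : hg f * T j = T j * hg (wact (sr j) f) + ks j *: hg (nabla j f).
  by rewrite e linearN scalerN addrNK.
rewrite -mulrA e mulrDr mulrA symmetrizer_T -hscalerAl -hscalerAr.
rewrite pi_T // linearD !linearZ /= mulrDr -!hscalerAr //.
Qed.

(** The letters are absorbed from the left, so the last one acts last. This reversal is the origin
    of the inverse in T_(wh^-1). *)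
Lemma symmetrizer_gralg_hprod s (f : A) : gralg_on L f ->
  oneW * hg f * hprod s = oneW * hg (pi (hprod (rev s)) f).
Proof.
elim: s f => [|j s IH] f Lf.
  by rewrite /hprod !big_nil mulr1 pi1.
have -> : hprod (j :: s) = T j * hprod s by rewrite /hprod big_cons.
rewrite mulrA symmetrizer_gralg_T // IH; last exact: pi_on.
by rewrite rev_cons -cats1 hprod_cat piM // [in RHS]/hprod big_seq1.
Qed.

(** * The quasi-polynomial representation on the orbit of [c] *)

Variable piqp : H -> A -> A.
Hypothesis Hqp : quasi_polynomial_representation piqp.
Variable c : E.
Hypothesis Hc : C0 dot Phi a L c.
Local Notation Wc := (weyl_stab dot Phi c).
Local Notation mr := (min_reps dot Phi a c).

Lemma qpM h h' (f : A) : piqp (h * h') f = piqp h (piqp h' f).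
Proof. exact: repM (qpr_rep Hqp) _ _ _ _. Qed.

Lemma qp1 (f : A) : piqp 1 f = f.
Proof. exact: rep1 (qpr_rep Hqp) _ _. Qed.

Lemma qp_linear h : linear (piqp h).
Proof. by move=> k f g; exact: rep_linear (qpr_rep Hqp) _ _ _ _ _ _. Qed.

HB.instance Definition _ h := GRing.isLinear.Build F A A _ (piqp h) (qp_linear h).

Lemma qp_linearl k h h' (f : A) : piqp (k *: h + h') f = k *: piqp h f + piqp h' f.
Proof. exact: rep_linearl (qpr_rep Hqp) _ _ _ _ _. Qed.

Lemma qpDl h h' (f : A) : piqp (h + h') f = piqp h f + piqp h' f.
Proof. by have := qp_linearl 1 h h' f; rewrite !scale1r. Qed.

Lemma qp0l (f : A) : piqp 0 f = 0.
Proof. by have := qp_linearl (-1) 0 0 f; rewrite scaler0 addr0 scaleN1r addNr. Qed.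

Lemma qpZl k h (f : A) : piqp (k *: h) f = k *: piqp h f.
Proof. by rewrite -[k *: h]addr0 qp_linearl // qp0l // addr0. Qed.

Lemma qp_sum (I : eqType) (s : seq I) (h : I -> H) (f : A) :
  piqp (\sum_(i <- s) h i) f = \sum_(i <- s) piqp (h i) f.
Proof.
elim: s => [|i s IH]; first by rewrite !big_nil qp0l.
by rewrite !big_cons qpDl IH.
Qed.

Lemma qp_gralgX y (h : A) : L y -> piqp (hg (xpow F y)) h = xpow F y * h.
Proof.
move=> /lattice_elt[l el]; rewrite -el (hecke_gralgX l).
apply: (@gralg_linear_ext (piqp (heckeX dot a t l)) (fun h => xpow F (\val l) * h)).
- exact: qp_linear.
- exact: mull_linear.
by move=> z; rewrite (qpr_X Hqp) xpowD.
Qed.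

Lemma qp_gralg (g h : A) : gralg_on L g -> piqp (hg g) h = g * h.
Proof.
move: g; apply: gralg_ind; first by rewrite linear0 qp0l mul0r.
move=> k y g Ly IH; rewrite hecke_gralg_linear qp_linearl IH (qp_gralgX h Ly).
by rewrite [RHS]mulrDl -scalerAl.
Qed.

(** A twisted Leibniz rule, read off from the cross relation; it reduces the action of T_j to the
    vectors x^(wc). *)
Lemma qp_T_gralg j (g h : A) : gralg_on L g ->
  piqp (T j) (g * h) = wact (sr j) g * piqp (T j) h + ks j *: (nabla j g * h).
Proof.
move=> Lg; have [Ln _] := nabla_spec j Lg; have Ls := wact_on (weyl_sr j) Lg.
rewrite -(qp_gralg h Lg) -qpM hecke_gralg_cross // addrC qp_linearl addrC.
by rewrite qpM !qp_gralg.
Qed.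

Lemma alcove_ge0 j : 0 <= a j c.
Proof.
have [alc _] := Hc; have : 0 <= a j c <= 1.
  by apply: alc; split; [exact: simple_root|exact: pos_simple].
by case/andP.
Qed.

(** If b(c) = 1, then y |-> s_b(y) + b^vee fixes c, while the condition on [c] allows only the
    translation part 0. *)
Lemma alcove_lt1 b : Phi b -> pos b -> b c < 1.
Proof.
move=> Pb pb; have [alc st] := Hc; have /andP[_ le1] := alc b (conj Pb pb).
rewrite lt_neqAle le1 andbT; apply/eqP => b1.
have : affine_stab dot Phi L c (refl dot b, coroot dot b).
  split; [exact: weyl_refl|exact: lattice_coroot|].
  by rewrite /= reflE b1 scale1r addrC subrK.
rewrite st => -[w _ [_ co0]]; have := coroot_pair dot (root_neq0 Pb).
by rewrite -co0 linear0 => /eqP; rewrite eq_sym pnatr_eq0.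
Qed.

Lemma orbit_lt1 b w : Phi b -> W w -> b (w c) < 1.
Proof.
move=> Pb Ww; have Pbw := root_weyl Ww Pb; rewrite -comp_lfunE.
case: (root_sign Pbw) => p; first exact: alcove_lt1.
apply: (@le_lt_trans _ _ 0) => //.
by have := pos_dom alcove_ge0 p; rewrite opp_lfunE oppr_ge0.
Qed.

Lemma orbit_gtN1 b w : Phi b -> W w -> -1 < b (w c).
Proof.
by move=> Pb Ww; have := orbit_lt1 (rootN Pb) Ww; rewrite opp_lfunE ltrNl.
Qed.

(** Translating wc back to w'c and applying w'^-1 fixes c, so the translation part has to vanish. *)
Lemma orbit_separated w w' : W w -> W w' -> L (w c - w' c) -> w c = w' c.
Proof.
move=> Ww Ww' Ll; have [_ st] := Hc; have Wi := weyl_inv Ww'.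
have : affine_stab dot Phi L c ((w'^-1 \o w)%VF, - (w'^-1)%VF (w c - w' c)).
  split; [exact: weyl_comp| |].
    by apply: subgroupN lattice_subgroup _; exact: lattice_weyl.
  rewrite /= linearB /= -![(w'^-1)%VF (_ c)]comp_lfunE weylVK // id_lfunE.
  by rewrite opprB subrK.
rewrite st => -[u _ [_ /esym/eqP]]; rewrite oppr_eq0 => /eqP e.
have := congr1 (fun y => w' y) e; rewrite linear0 -comp_lfunE weylKV // id_lfunE.
by move/eqP; rewrite subr_eq0 => /eqP.
Qed.

Lemma qp_TX0 j w : W w -> a j (w c) = 0 -> piqp (T j) (xpow F (w c)) = ts j *: xpow F (w c).
Proof.
move=> Ww e; rewrite (qpr_T Hqp) /chi e int_num0 floor0 mulr0z subr0 subrr sr_fix //.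
by rewrite (gdivE (h := 0)) ?coroot_neq0 ?mul0r // scaler0 addr0.
Qed.

Lemma qp_TXpos j w : W w -> 0 < a j (w c) ->
  piqp (T j) (xpow F (w c)) = xpow F (sr j (w c)).
Proof.
move=> Ww gt; have lt := orbit_lt1 (simple_root j) Ww.
have fl : Num.floor (a j (w c)) = 0.
  by apply: floor_def; rewrite add0r ltW //=.
have ni : (a j (w c) \is a Num.int) = false.
  apply/negP => /floorK; rewrite fl => e; by rewrite -e ltxx in gt.
rewrite (qpr_T Hqp) /chi ni scale1r fl mulr0z subr0 subrr.
by rewrite (gdivE (h := 0)) ?coroot_neq0 ?mul0r // scaler0 addr0.
Qed.

Lemma qp_TXneg j w : W w -> a j (w c) < 0 ->
  piqp (T j) (xpow F (w c)) = xpow F (sr j (w c)) + ks j *: xpow F (w c).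
Proof.
move=> Ww lt; have gt := orbit_gtN1 (simple_root j) Ww.
have fl : Num.floor (a j (w c)) = -1.
  by apply: floor_def; rewrite addNr lt /= andbT ltW.
have ni : (a j (w c) \is a Num.int) = false.
  apply/negP => /floorK; rewrite fl => e; by rewrite -e ltxx in gt.
rewrite (qpr_T Hqp) /chi ni scale1r fl mulrN1z opprK.
(* With floor -1 the numerator is x^(wc + co_j) - x^(wc), so the quotient is x^(wc) itself. *)
rewrite (gdivE (h := xpow F (w c))) ?coroot_neq0 //.
by rewrite mulrBr mulr1 -xpowD.
Qed.

(** * Coefficients at the points of the orbit *)

Local Notation orb := ([set z | exists2 v, W v & L (z - v c)]).

Lemma orb_gralg w (g : A) : W w -> gralg_on L g -> gralg_on orb (g * xpow F (w c)).
Proof.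
move=> Ww; move: g; apply: gralg_ind; first by rewrite mul0r; exact: gralg_on0.
move=> k y g Ly IH; rewrite mulrDl -scalerAl -xpowD; apply: gralg_on_lin => //.
by apply: gralg_onX; exists w; rewrite // addrK.
Qed.

Lemma orbX_split z : orb z -> exists l v, [/\ L l, W v & xpow F z = xpow F l * xpow F (v c)].
Proof. by move=> [v Wv Lz]; exists (z - v c), v; split=> //; rewrite -xpowD subrK. Qed.

Lemma lcoef_orbit w v : W w -> W v ->
  lcoef L (w c) (xpow F (v c)) = (v c == w c)%:R.
Proof.
move=> Ww Wv; rewrite lcoefX; case: asboolP => [/(orbit_separated Wv Ww) e|nL].
  by rewrite e eqxx subrr.
by case: eqP => // e; case: nL; rewrite e subrr; case: lattice_subgroup.
Qed.

Lemma qp_T_orb j (h : A) : gralg_on orb h -> gralg_on orb (piqp (T j) h).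
Proof.
move: h; apply: gralg_ind; first by rewrite linear0; exact: gralg_on0.
move=> k z h /orbX_split[l [v [Ll Wv ->]]] IH; rewrite qp_linear; apply: gralg_on_lin => //.
have Lx : gralg_on L (xpow F l) by exact: gralg_onX.
have [Ln _] := nabla_spec j Lx.
have Ls := wact_on (weyl_sr j) Lx; have Ws := weyl_srl j Wv.
have srE : sr j (v c) = (sr j \o v)%VF c by rewrite comp_lfunE.
rewrite (qp_T_gralg _ _ Lx); apply: gralg_onD; last by apply: gralg_onZ; exact: orb_gralg.
have [lt|gt|e] := ltgtP (a j (v c)) 0.
- rewrite (qp_TXneg Wv lt) mulrDr -scalerAr srE; apply: gralg_onD; first exact: orb_gralg.
  by apply: gralg_onZ; exact: orb_gralg.
- by rewrite (qp_TXpos Wv gt) srE; exact: orb_gralg.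
- by rewrite (qp_TX0 Wv e) -scalerAr; apply: gralg_onZ; exact: orb_gralg.
Qed.

(** The action of T_j sorted by target: x^(wc) arises from x^(s_j wc) and, diagonally, from x^(wc).
    These two sources coincide when a_j(wc) = 0, hence the separate case. *)
Lemma lcoef_qp_TX j w v : W w -> W v ->
  lcoef L (w c) (piqp (T j) (xpow F (v c))) =
  if a j (w c) == 0 then ts j *: (v c == w c)%:R
  else (v c == sr j (w c))%:R + (if a j (w c) < 0 then ks j else 0) *: (v c == w c)%:R.
Proof.
move=> Ww Wv; have Wvs := weyl_srl j Wv.
have srE (u : 'End(E)) : sr j (u c) = (sr j \o u)%VF c by rewrite comp_lfunE.
have srr y : sr j (sr j y) = y by rewrite reflK ?simple_neq0.
have e1 : lcoef L (w c) (xpow F (sr j (v c))) = (sr j (v c) == w c)%:R.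
  by rewrite srE lcoef_orbit.
have e2 : (sr j (v c) == w c) = (v c == sr j (w c)).
  by apply/eqP/eqP => [<-|->].
have ne y : a j y != 0 -> (y == sr j y) = false.
  move=> ny; apply/negP => /eqP e; have := simple_sr j y; rewrite -e => h.
  by case/eqP: ny; lra.
have [vw|nvw] := eqVneq (v c) (w c).
  have [lt|gt|e] := ltgtP (a j (v c)) 0; rewrite -vw.
  - rewrite (qp_TXneg Wv lt) (lt_eqF lt) lt linearD linearZ /= !(srE v).
    rewrite (lcoef_orbit Wv Wvs) (lcoef_orbit Wv Wv).
    by rewrite -srE eqxx eq_sym.
  - rewrite (qp_TXpos Wv gt) (gt_eqF gt) ltNge (ltW gt) /= scale0r addr0.
    by rewrite !(srE v) lcoef_orbit // -srE eq_sym.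
  - by rewrite (qp_TX0 Wv e) e eqxx linearZ /= lcoef_orbit // eqxx.
rewrite !scaler0 addr0.
have [lt|gt|e] := ltgtP (a j (v c)) 0.
- rewrite (qp_TXneg Wv lt) linearD linearZ /= e1 e2 lcoef_orbit // (negPf nvw) scaler0 addr0.
  case: (a j (w c) =P 0) => [w0|//]; case: eqP => // e; move: lt.
  by rewrite e simple_sr w0 oppr0 ltxx.
- rewrite (qp_TXpos Wv gt) e1 e2; case: (a j (w c) =P 0) => [w0|//]; case: eqP => // e; move: gt.
  by rewrite e simple_sr w0 oppr0 ltxx.
rewrite (qp_TX0 Wv e) linearZ /= lcoef_orbit // (negPf nvw) scaler0.
case: (a j (w c) =P 0) => // _; case: eqP => // e'; case/eqP: nvw.
by rewrite -[RHS]srr -e' sr_fix.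
Qed.

(** Linearity of the right-hand side of [lcoef_qp_T]: p, q and n stand for the terms s_j p, s_j q
    and nabla_j p there. *)
Lemma step_lincomb (V : lmodType F) (k x y z : F) (b : bool) (p p' q q' n n' : V) :
  (if b then x *: (k *: p + p') else k *: q + q' + z *: (k *: p + p')) + y *: (k *: n + n') =
  k *: ((if b then x *: p else q + z *: p) + y *: n) +
  ((if b then x *: p' else q' + z *: p') + y *: n').
Proof.
have lc (u v : F) (r1 r2 r3 r4 : V) :
    u *: (k *: r1 + r2) + v *: (k *: r3 + r4) = k *: (u *: r1 + v *: r3) + (u *: r2 + v *: r4).
  by rewrite !scalerDr !scalerA ![k * _]mulrC addrACA.
case: b; first exact: lc.
have e1 := lc 1 z q q' p p'; rewrite !scale1r in e1; rewrite e1.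
by have := lc 1 y (q + z *: p) (q' + z *: p') n n'; rewrite !scale1r.
Qed.

Lemma mul_if (b : bool) (x y : F) (p q v : A) :
  p * (if b then x *: v else q + y *: v) = if b then x *: (p * v) else p * q + y *: (p * v).
Proof. by case: b; rewrite ?mulrDr -scalerAr. Qed.

(** The engine of the proof. Both sides are linear in h, and on x^l x^(vc) the Leibniz rule leaves
    only the matrix coefficients of [lcoef_qp_TX]. For a_j(wc) < 0 the coefficient at s_j wc occurs
    only as its image under s_j, so the formula can be solved for it. *)
Lemma lcoef_qp_T j w (h : A) : W w -> gralg_on orb h ->
  lcoef L (w c) (piqp (T j) h) =
  (if a j (w c) == 0 then ts j *: wact (sr j) (lcoef L (w c) h)
   else wact (sr j) (lcoef L (sr j (w c)) h) +
     (if a j (w c) < 0 then ks j else 0) *: wact (sr j) (lcoef L (w c) h))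
  + ks j *: nabla j (lcoef L (w c) h).
Proof.
move=> Ww; have Ws := weyl_srl j Ww.
have srE (u : 'End(E)) : sr j (u c) = (sr j \o u)%VF c by rewrite comp_lfunE.
pose Rf (p q : A) := (if a j (w c) == 0 then ts j *: wact (sr j) p
   else wact (sr j) q + (if a j (w c) < 0 then ks j else 0) *: wact (sr j) p)
  + ks j *: nabla j p.
rewrite -/(Rf _ _); move: h; apply: gralg_ind.
  by rewrite /Rf !linear0 nabla0 !scaler0 !addr0 if_same.
move=> k z h /orbX_split[l [v [Ll Wv ->]]] IH.
have Lx : gralg_on L (xpow F l) by exact: gralg_onX.
have Wvs := weyl_srl j Wv.
set f := _ * xpow F (v c).
have linR (p1 p2 q1 q2 : A) : gralg_on L p1 -> gralg_on L p2 ->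
  Rf (k *: p1 + p2) (k *: q1 + q2) = k *: Rf p1 q1 + Rf p2 q2.
  move=> Lp1 Lp2; rewrite /Rf (nabla_linear _ _ Lp1 Lp2) (wact_linear _ _ p1) (wact_linear _ _ q1).
  exact: (step_lincomb k (ts j) (ks j) (if a j (w c) < 0 then ks j else 0) (a j (w c) == 0)
    (wact (sr j) p1) (wact (sr j) p2) (wact (sr j) q1) (wact (sr j) q2)).
rewrite qp_linear (lcoef_linear _ _ _ (piqp _ _)) (lcoef_linear _ _ _ f) (lcoef_linear _ (sr j (w c)) _ f).
have Lp (q : A) : gralg_on L (lcoef L (w c) q) by exact: lcoef_on.
rewrite (linR _ _ _ _ (Lp f) (Lp h)) IH.
suff -> : lcoef L (w c) (piqp (T j) f) = Rf (lcoef L (w c) f) (lcoef L (sr j (w c)) f) by [].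
have [Ln _] := nabla_spec j Lx; have Ls := wact_on (weyl_sr j) Lx.
have Lsub := lattice_subgroup.
have wb (b : bool) : wact (sr j) (b%:R : A) = b%:R.
  by case: b; rewrite ?linear0 // wact_one.
have nb (b : bool) : nabla j (xpow F l * b%:R) = nabla j (xpow F l) * b%:R.
  by case: b; rewrite ?mulr1 // !mulr0 nabla0.
rewrite /f /Rf (qp_T_gralg _ _ Lx) linearD linearZ /=.
rewrite (lcoefM Lsub _ _ Ls) (lcoefM Lsub _ _ Ln) (lcoef_qp_TX _ Ww Wv).
rewrite (srE w) !(lcoefM Lsub _ _ Lx) (lcoef_orbit Ww Wv) (lcoef_orbit Ws Wv) -srE.
by rewrite !wactM !wb nb mul_if.
Qed.

Lemma sum_linear (S : set 'End(E)) (U V : lmodType F) (p : 'End(E) -> U -> V) :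
  finite_set S -> (forall u, linear (p u)) -> linear (fun h => \sum_(u \in S) p u h).
Proof.
move=> fS lp k f g; rewrite !(fsbig_finite _ _ fS) scaler_sumr -big_split /=.
by apply: eq_bigr => u _; rewrite lp.
Qed.

Lemma sum_lcoef (S : set 'End(E)) (V : lmodType F) (p : A -> V) (g : 'End(E) -> A) :
  finite_set S -> linear p -> p (\sum_(u \in S) g u) = \sum_(u \in S) p (g u).
Proof.
move=> fS lp; rewrite !fsbig_finite //.
pose P : {linear A -> V} := HB.pack p (GRing.isLinear.Build F A V _ p lp).
exact: (linear_sum P).
Qed.

Lemma scale_fsum (V : lmodType F) (S : set 'End(E)) k (x : 'End(E) -> F) (h : 'End(E) -> V) :
  finite_set S -> k *: \sum_(u \in S) x u *: h u = \sum_(u \in S) (k * x u) *: h u.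
Proof.
move=> fS; rewrite !(fsbig_finite _ _ fS) scaler_sumr.
by apply: eq_bigr => u _; rewrite scalerA.
Qed.

Lemma min_reps_finite : finite_set mr.
Proof. by apply: sub_finite_set weyl_finite => w []. Qed.

Lemma mr_weyl w : mr w -> W w. Proof. by case. Qed.

Lemma sum_min_reps1 (g : 'End(E) -> A) w : mr w -> (forall u, mr u -> u c <> w c -> g u = 0) ->
  \sum_(u \in mr) g u = g w.
Proof.
move=> mw h; rewrite -(fsbig_widen [set w] mr) ?fsbig_set1 //; first by move=> _ ->.
move=> u [mu nu]; apply: h => // e; apply: nu.
exact: (min_reps_inj alcove_ge0).
Qed.

Lemma lcoef_expansion (h : A) : gralg_on orb h ->
  h = \sum_(u \in mr) lcoef L (u c) h * xpow F (u c).
Proof.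
have linE : linear (fun h => \sum_(u \in mr) lcoef L (u c) h * xpow F (u c)).
  apply: (@sum_linear mr A A (fun u h => lcoef L (u c) h * xpow F (u c))).
    exact: min_reps_finite.
  by move=> u k f g; rewrite lcoef_linear mulr_linear.
move: h; apply: (@linear_gralg_eq F E A orb id
  (fun h => \sum_(u \in mr) lcoef L (u c) h * xpow F (u c))) => // z /orbX_split[l [v [Ll Wv ->]]].
have [w [u [mw [Wu uc] ev]]] := min_reps_ex c Wv.
have vc : v c = w c by rewrite ev comp_lfunE uc.
have Ww := mr_weyl mw; have Lx : gralg_on L (xpow F l) by exact: gralg_onX.
have Lsub := lattice_subgroup; rewrite vc (@sum_min_reps1 _ w) //.
  by rewrite lcoefM // lcoef_orbit // eqxx mulr1.
move=> w' /mr_weyl Ww' ne; rewrite lcoefM // lcoef_orbit //.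
by case: eqP => [/esym //|_]; rewrite mulr0 mul0r.
Qed.

(** [gamma_qp] selects some family of coordinates. Applying [lcoef] to any expansion returns its
    coordinate at w, and [lcoef_expansion] ensures that there is one. *)
Lemma gamma_qpE w (h : A) : mr w -> gralg_on orb h -> gamma_qp dot Phi a L c w h = lcoef L (w c) h.
Proof.
move=> mw oh; rewrite /gamma_qp; case: xgetP => [d _ [Ld ->]|/(_ (fun u => lcoef L (u c) h))].
  rewrite sum_lcoef; [|exact: min_reps_finite|exact: lcoef_linear].
  have Ww := mr_weyl mw; have Lsub := lattice_subgroup.
  rewrite (@sum_min_reps1 _ w) //.
    by rewrite lcoefM ?lcoef_orbit ?eqxx ?mulr1 //; exact: Ld.
  move=> u mu ne; have Wu := mr_weyl mu.
  by rewrite lcoefM ?lcoef_orbit //; [case: eqP => //; rewrite mulr0|exact: Ld].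
by case; split; [move=> u _; exact: lcoef_on|exact: lcoef_expansion].
Qed.

Lemma qp_hprod_orb s (h : A) : gralg_on orb h -> gralg_on orb (piqp (hprod s) h).
Proof.
move=> oh; elim: s => [|j s IH]; first by rewrite /hprod big_nil qp1.
by rewrite /hprod big_cons qpM; exact: qp_T_orb.
Qed.

Lemma xc_orb (g : A) : gralg_on L g -> gralg_on orb (g * xpow F c).
Proof. by move=> Lg; have := orb_gralg weyl1 Lg; rewrite id_lfunE. Qed.

(** Each T_j moves a point of the orbit by at most the reflection s_j, so the factors of [hprod s]
    are too few to lead from c to wc. *)
Lemma lcoef_qp_hprod0 s w (g : A) : W w -> gralg_on L g ->
  (forall s', word s' c = w c -> (size s < size s')%N) ->
  lcoef L (w c) (piqp (hprod s) (g * xpow F c)) = 0.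
Proof.
move=> Ww Lg; elim: s w Ww => [|j s IH] w Ww min.
  rewrite /hprod big_nil qp1 lcoefM //; last exact: lattice_subgroup.
  rewrite -[c in xpow F c]id_lfunE lcoef_orbit //; last exact: weyl1.
  by case: eqP => [/(min [::])//|_]; rewrite mulr0.
rewrite /hprod big_cons qpM lcoef_qp_T //; last exact: qp_hprod_orb (xc_orb Lg).
have e1 : lcoef L (w c) (piqp (hprod s) (g * xpow F c)) = 0.
  by apply: IH => // s' /min; exact: ltnW.
have e2 : lcoef L (sr j (w c)) (piqp (hprod s) (g * xpow F c)) = 0.
  rewrite -comp_lfunE; apply: IH; first exact: weyl_srl.
  rewrite comp_lfunE => s' e; have := min (j :: s').
  by rewrite /= comp_lfunE e reflK ?simple_neq0 //; apply.
by rewrite -/(hprod s) e1 e2 !linear0 nabla0 !scaler0 !addr0 if_same.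
Qed.

(** At the greatest reachable distance only the reflecting term of each T_j contributes. The other
    terms involve the coefficient at the target before the last factor acts, which is 0 by
    [lcoef_qp_hprod0]. *)
Lemma lcoef_qp_hprod1 s (g : A) : gralg_on L g ->
  (forall s', word s' c = word s c -> (size s <= size s')%N) ->
  lcoef L (word s c) (piqp (hprod s) (g * xpow F c)) = wact (word s) g.
Proof.
move=> Lg; elim: s => [|j s IH] min.
  rewrite /hprod big_nil qp1 lcoefM //; last exact: lattice_subgroup.
  rewrite -[c in xpow F c]id_lfunE lcoef_orbit //; try exact: weyl1.
  by rewrite eqxx mulr1 wact1.
have Ws := weyl_word s; have Wjs := weyl_word (j :: s).
have e0 : word (j :: s) c = sr j (word s c) by rewrite /= comp_lfunE.
have srr y : sr j (sr j y) = y by rewrite reflK ?simple_neq0.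
rewrite /hprod big_cons qpM lcoef_qp_T //; last exact: qp_hprod_orb (xc_orb Lg).
rewrite -/(hprod s) lcoef_qp_hprod0 // linear0 nabla0 !scaler0 !addr0.
case: eqP => [z|_].
  have e : word s c = word (j :: s) c by rewrite -[LHS]srr -e0 sr_fix.
  by have := min s e; rewrite /= ltnn.
rewrite e0 srr IH ?wact_comp // => s' e; have := min (j :: s').
by rewrite ltnS; apply; rewrite /= !comp_lfunE e.
Qed.

(** If a_j(c) = 0, then T_j x^c = t_j x^c, and the Leibniz rule becomes the formula for pi(T_j). *)
Lemma qp_stab s (g : A) : (forall j, j \in s -> a j c = 0) -> gralg_on L g ->
  piqp (hprod s) (g * xpow F c) = pi (hprod s) g * xpow F c.
Proof.
move=> h Lg; elim: s h => [|j s IH] h; first by rewrite /hprod big_nil qp1 pi1.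
have Lp : gralg_on L (pi (hprod s) g) by exact: pi_on.
have [Ln _] := nabla_spec j Lp.
have j0 : a j c = 0 by apply: h; rewrite mem_head.
rewrite /hprod big_cons qpM piM // -/(hprod s) IH; last first.
  by move=> i si; apply: h; rewrite inE si orbT.
rewrite qp_T_gralg // pi_T // mulrDl -!scalerAl.
have := qp_TX0 (j := j) weyl1; rewrite id_lfunE => -> //.
by rewrite -scalerAr.
Qed.

Lemma qp_stab_Tw u (g : A) : Wc u -> gralg_on L g ->
  piqp (Tw u) (g * xpow F c) = pi (Tw u) g * xpow F c.
Proof.
move=> [Wu /= uc] Lg; rewrite Tw_hprod; apply: qp_stab => //.
have [e rs] := redexprP Wu; apply: (stab_word alcove_ge0) rs _; by rewrite e.
Qed.

Lemma word_min_reps w s : mr w -> word s c = w c -> (len w <= size s)%N.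
Proof.
move=> mw e; have Ww := mr_weyl mw; have Ws := weyl_word s.
have Wu : Wc (w^-1 \o word s)%VF.
  split; first by apply: weyl_comp => //; exact: weyl_inv.
  by rewrite /= comp_lfunE e -comp_lfunE weylVK // id_lfunE.
apply: leq_trans (len_word s).
by rewrite -[word s](weyl_compKV _ Ww) (min_reps_len alcove_ge0) // leq_addr.
Qed.

(** * The antidominant coefficient and the recursion *)

Section TopCoefficient.
Variables (g : A) (Lg : gralg_on L g).
Local Notation G := (piqp oneW (g * xpow F c)).
Local Notation F0 := (pi (symmetrizer dot a t L Wc) g).

Lemma G_orb : gralg_on orb G.
Proof.
rewrite /symmetrizer fsbig_finite ?qp_sum; last exact: weyl_finite.
elim/big_rec: _ => [|u f _ of']; first exact: gralg_on0.
apply: gralg_onD => //; rewrite qpZl; apply: gralg_onZ; rewrite Tw_hprod.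
exact: qp_hprod_orb (xc_orb Lg).
Qed.

(** Write v = w'u with u in W_c. T_u stays in F[L] x^c, and l(w') < l(w) factors cannot reach the
    antidominant point. *)
Lemma lcoef_qp_Tw w v : mr w -> W v -> (forall j, a j (w c) <= 0) -> v c <> w c ->
  lcoef L (w c) (piqp (Tw v) (g * xpow F c)) = 0.
Proof.
move=> mw Wv anti ne; have Ww := mr_weyl mw.
have [w' [u [mw' Wu ev]]] := min_reps_ex c Wv.
have [Wu' uc] := Wu; have Ww' := mr_weyl mw'.
have ne' : w' c <> w c by rewrite -[in w' c]uc -comp_lfunE -ev.
rewrite ev Tw_comp //; last exact: (min_reps_len alcove_ge0).
rewrite qpM qp_stab_Tw // Tw_hprod; apply: lcoef_qp_hprod0 => //; first exact: pi_on.
move=> s' e; apply: leq_trans (word_min_reps mw e).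
exact: (min_reps_top_len alcove_ge0).
Qed.

(** The terms that survive in 1^+ are v = wu with u in W_c. There t and T factor, T_u acts through
    pi, and T_w contributes w by [lcoef_qp_hprod1]. *)
Lemma lcoef_top w : mr w -> (forall j, a j (w c) <= 0) ->
  lcoef L (w c) G = tw w *: wact w F0.
Proof.
move=> mw anti; have Ww := mr_weyl mw; have fW := weyl_finite.
have SW : Wc `<=` W by move=> u [].
have fWc := sub_finite_set SW fW.
pose Q := [set v | W v /\ v c = w c].
have -> : lcoef L (w c) G = \sum_(v \in W) tw v *: lcoef L (w c) (piqp (Tw v) (g * xpow F c)).
  transitivity (\sum_(v \in W) lcoef L (w c) (tw v *: piqp (Tw v) (g * xpow F c))); last first.
    by apply: eq_fsbigr => v _; rewrite linearZ.
  rewrite -(sum_lcoef _ fW (lcoef_linear _ _)).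
  rewrite /symmetrizer !fsbig_finite // qp_sum; congr lcoef.
  by apply: eq_bigr => v _; rewrite qpZl.
rewrite -(fsbig_widen Q W); first last.
- move=> v [Wv nQ]; rewrite /= lcoef_qp_Tw ?scaler0 // => e.
  by apply: nQ.
- by move=> v [].
rewrite (reindex_fsbig (fun u => w \o u)%VF Wc Q); last first.
  split.
  - move=> u [Wu /= uc]; split; first exact: weyl_comp.
    by rewrite comp_lfunE uc.
  - by move=> u u' _ _ /(congr1 (fun x => w^-1 \o x)%VF); rewrite !weyl_compVK.
  - move=> v [Wv vc]; exists (w^-1 \o v)%VF; last by rewrite weyl_compKV.
    split; first by apply: weyl_comp => //; exact: weyl_inv.
    by rewrite /= comp_lfunE vc -comp_lfunE weylVK // id_lfunE.
have -> : wact w F0 = \sum_(u \in Wc) tw u *: wact w (pi (Tw u) g).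
  transitivity (\sum_(u \in Wc) wact w (tw u *: pi (Tw u) g)); last first.
    by apply: eq_fsbigr => u _; rewrite wactZ.
  rewrite -(sum_lcoef _ fWc (wact_linear w)) /symmetrizer !fsbig_finite // pi_sum //.
  by congr wact; apply: eq_bigr => u _; rewrite piZl.
rewrite (scale_fsum _ _ _ fWc); apply: eq_fsbigr => u /set_mem Wu; have [Wu' uc] := Wu.
have l := min_reps_len alcove_ge0 mw Wu.
rewrite (tw_comp Ww Wu' l) (Tw_comp Ww Wu' l) qpM (qp_stab_Tw Wu Lg).
have -> // : lcoef L (w c) (piqp (Tw w) (pi (Tw u) g * xpow F c)) = wact w (pi (Tw u) g).
have [s es rs] := reduced_ex Ww; rewrite -es Tw_word // lcoef_qp_hprod1 //; first exact: pi_on.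
by rewrite es => s' /(word_min_reps mw); rewrite -es ((reducedP s).1 rs).
Qed.

Lemma F0_on : gralg_on L F0. Proof. exact: pi_on. Qed.

Lemma F0_T j : a j c = 0 -> pi (T j) F0 = ts j *: F0.
Proof.
move=> j0; rewrite -(piM _ _ Lg) T_symmetrizer ?(piZl _ _ Lg) //; first by move=> u [].
by move=> u; apply: stab_comp; split; [exact: weyl_sr|exact: sr_fix].
Qed.

Lemma eigen_factor (V : comAlgType F) (x : F) (D n X : V) : x != 0 ->
  x *: D + (x - x^-1) *: n = 0 -> n * (X - 1) = D -> D * ((x * x) *: X - 1) = 0.
Proof.
move=> x0 e en.
have <- : x *: ((x *: D + (x - x^-1) *: n) * (X - 1)) = D * ((x * x) *: X - 1).
  rewrite mulrDl -!scalerAl en !mulrBr !mulr1 scalerBr scalerBl addrA subrK.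
  by rewrite scalerBr !scalerA mulfV // scale1r scalerAr.
by rewrite e mul0r scaler0.
Qed.

(** For D = s_j p - p the eigenvalue equation reads t_j D + k_j nabla_j p = 0. Multiplied by t_j
    (x^(co_j) - 1) it becomes D (t_j^2 x^(co_j) - 1) = 0, and [binomial_regular] gives D = 0,
    whatever the value of t_j^2. *)
Lemma T_eigen_fixed j (p : A) : gralg_on L p -> pi (T j) p = ts j *: p -> wact (sr j) p = p.
Proof.
move=> Lp; rewrite (pi_T _ Lp) => e; have [_ en] := nabla_spec j Lp.
have t0 := t_neq0 j; set D := wact (sr j) p - p in en.
have eD : ts j *: D + ks j *: nabla j p = 0.
  by rewrite /D scalerBr addrAC e subrr.
have h := eigen_factor t0 eD en.
have := binomial_regular (mulf_neq0 t0 t0) (coroot_neq0 j) h.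
by move/eqP; rewrite subr_eq0 => /eqP.
Qed.

Lemma F0_word s : (forall j, j \in s -> a j c = 0) ->
  wact (word s) F0 = F0 /\ pi (hprod s) F0 = (\prod_(j <- s) ts j) *: F0.
Proof.
have L0 := F0_on; elim: s => [|j s IH] h.
  by rewrite /hprod !big_nil wact1 pi1 // scale1r.
have [e1 e2] : wact (word s) F0 = F0 /\ pi (hprod s) F0 = (\prod_(j <- s) ts j) *: F0.
  by apply: IH => i si; apply: h; rewrite inE si orbT.
have j0 : a j c = 0 by apply: h; rewrite mem_head.
split; first by rewrite /= -wact_comp e1 (T_eigen_fixed L0 (F0_T j0)).
rewrite /hprod !big_cons -/(hprod s) (piM _ _ L0) e2 (piZ _ _ L0) (F0_T j0).
by rewrite scalerA mulrC.
Qed.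

Lemma F0_stab u : Wc u -> wact u F0 = F0 /\ pi (Tw u) F0 = tw u *: F0.
Proof.
move=> [Wu /= uc]; have [s es rs] := reduced_ex Wu.
have h : forall j, j \in s -> a j c = 0.
  by apply: (stab_word alcove_ge0 rs); rewrite es.
by have := F0_word h; rewrite -Tw_word // -tw_word // es.
Qed.

Lemma F0_Tw_inv u : Wc u -> pi (hecke_inv (Tw u)) F0 = (tw u)^-1 *: F0.
Proof.
move=> Wu; have [_ e] := F0_stab Wu; have L0 := F0_on; have [eT _] := Tw_inv u.
have := congr1 (pi (hecke_inv (Tw u))) e; rewrite -(piM _ _ L0) eT (pi1 L0) (piZ _ _ L0).
by move=> e'; rewrite [X in _ = _ *: X]e' scalerA (mulVf (tw_neq0 u)) scale1r.
Qed.

Lemma G_T j : piqp (T j) G = ts j *: G.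
Proof.
rewrite -qpM T_symmetrizer ?qpZl // => w; exact: weyl_srl.
Qed.

(* The right-hand side of the theorem when g = pi(T_(wh^-1))f. *)
Definition target w : A := tw w0 *: wact w0 (pi (hecke_inv (Tw (w0 \o w)^-1%VF)) F0).

Lemma t_opp b b' : Phi b' -> b' = - b -> Phi b -> t b' = t b.
Proof.
move=> _ -> Pb; case: Ht => _ inv; have Wb := weyl_refl Pb.
have b0 := root_neq0 Pb.
rewrite -(inv b _ Pb Wb) (weyl_invE Wb (refl_comp dot b0)) comp_refl coroot_pair //.
by rewrite scaler_nat mulr2n opprD addrA subrr add0r.
Qed.

(** w_0 sends co_j' to - co_j, and so does s_j with co_j. Both sides thus have the denominator
    x^(-co_j) - 1; the sign arises because s_j exchanges the two terms of s_j h - h, for h = w_0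
    p. *)
Lemma longest_nabla j j' (p : A) : gralg_on L p ->
  (w0 \o (sr j \o w0))%VF = sr j' -> a j' = - (a j \o w0)%VF ->
  wact w0 (nabla j' p) = - wact (sr j) (nabla j (wact w0 p)).
Proof.
move=> Lp ej ea; have Ww0 := longest_weyl; have Lp' := wact_on Ww0 Lp.
have [_ e1] := nabla_spec j' Lp; have [_ e2] := nabla_spec j Lp'.
have co' : w0 (co j') = - co j.
  by rewrite ea corootN linearN /= (coroot_conj (a j) (weyl_isom Ww0) longest_invol).
have sco : sr j (co j) = - co j.
  by rewrite reflE coroot_pair ?simple_neq0 // scaler_nat mulr2n opprD addrA subrr add0r.
have := congr1 (wact w0) e1; rewrite wactM !wactB wactX co' wact_one wact_comp.
have -> : (w0 \o sr j')%VF = (sr j \o w0)%VF.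
  by rewrite -ej comp_lfunA longest_invol comp_lfun1l.
move=> e1'; have := congr1 (wact (sr j)) e2.
rewrite wactM !wactB wactX sco wact_one wact_comp srK wact1 wact_comp => e2'.
apply/eqP; rewrite -subr_eq0 opprK; apply/eqP.
apply: (@binomial_regular _ _ F 1 (- co j)); rewrite ?oner_eq0 ?oppr_eq0 ?coroot_neq0 //.
by rewrite scale1r mulrDl e1' e2' -[X in _ + X]opprB subrr.
Qed.

Lemma scale_lincomb (V : lmodType F) (x y z : F) (p q u : V) :
  x *: (y *: p + z *: (- q) - z *: u) = (y *: (x *: p) - z *: (x *: q)) - z *: (x *: u).
Proof. by rewrite scalerN !scalerBr !scalerA (mulrC x y) (mulrC x z). Qed.

Lemma linear_lincomb (U V : lmodType F) (phi : U -> V) (y z : F) (p q u : U) :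
  linear phi -> phi (y *: p + z *: q - z *: u) = y *: phi p + z *: phi q - z *: phi u.
Proof.
move=> lphi; pose P : {linear U -> V} := HB.pack phi (GRing.isLinear.Build F U V _ phi lphi).
by rewrite -[phi]/(P : U -> V) linearB linearD !linearZ.
Qed.

Lemma linear_lincomb2 (U V : lmodType F) (phi : U -> V) (x y z : F) (p q : U) :
  linear phi -> phi (y *: (x *: p) - z *: (x *: q)) = y *: (x *: phi p) - z *: (x *: phi q).
Proof.
move=> lphi; pose P : {linear U -> V} := HB.pack phi (GRing.isLinear.Build F U V _ phi lphi).
have PZ k u : P (k *: u) = k *: P u by rewrite linearZ.
by rewrite -[phi]/(P : U -> V) linearB !PZ.
Qed.

(** Split T_j'^-1 = T_j' - k_j off the inverse and move w_0 past it with [longest_nabla]. The result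
    is the eigenvalue equation T_j G = t_j G at s_j wc, solved for the coefficient at wc. *)
Lemma target_step w j : mr w -> 0 < a j (w c) ->
  target w = wact (sr j) (ts j *: target (sr j \o w)%VF - ks j *: nabla j (target (sr j \o w)%VF))
             - ks j *: target (sr j \o w)%VF.
Proof.
move=> mw gt; have Ww := mr_weyl mw; have [mw1 l] := min_reps_up alcove_ge0 mw gt.
have Ww1 := mr_weyl mw1; have Ww0 := longest_weyl; have L0 := F0_on.
have [j' [ej ea]] := longest_conj j.
(* Up to sign a_j' is in the W-orbit of a_j, and t is W-invariant. *)
have tsj : ts j' = ts j.
  have Pj := simple_root j; have Pjw := root_weyl Ww0 Pj.
  rewrite (t_opp (simple_root j') ea Pjw) -[X in t (_ \o X)%VF]longest_inv.
  by case: Ht => _ ->.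
pose g1 := pi (hecke_inv (Tw (w0 \o (sr j \o w))^-1%VF)) F0.
have Lg1 : gralg_on L g1 by exact: pi_on.
have e0 : (w0 \o w)%VF = (sr j' \o (w0 \o (sr j \o w)))%VF.
  by rewrite -ej -!comp_lfunA (comp_lfunA w0 w0) longest_invol comp_lfun1l sr_compK.
have Wx : W (w0 \o (sr j \o w))%VF by exact: weyl_comp.
have eT : Tw (w0 \o w)^-1%VF = Tw (w0 \o (sr j \o w))^-1%VF * T j'.
  have Wj' := weyl_sr j'.
  rewrite e0 weyl_invM // (weyl_invE Wj' (srK j')) Tw_comp ?Tw_sr //; first exact: weyl_inv.
  have := len_longest_mul Ww; have := len_longest_mul Ww1; rewrite l e0.
  rewrite -(len_inv (weyl_comp Wj' Wx)) weyl_invM // (weyl_invE Wj' (srK j')).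
  rewrite (len_inv Wx) len_sr => h1 h2; apply/eqP.
  by rewrite -(eqn_add2r (len w)) h2 -h1 addn1 addSnnS.
have [i1 i2] := Tw_inv (w0 \o (sr j \o w))^-1%VF.
have eI : hecke_inv (Tw (w0 \o w)^-1%VF) = Tinv j' * hecke_inv (Tw (w0 \o (sr j \o w))^-1%VF).
  apply: hecke_invE; rewrite eT -mulrA.
    by rewrite (mulrA (T j')) Tinvr mul1r i2.
  by rewrite (mulrA (hecke_inv _)) i1 mul1r Tinvl.
have eP : pi (hecke_inv (Tw (w0 \o w)^-1%VF)) F0 =
    ts j *: wact (sr j') g1 + ks j *: nabla j' g1 - ks j *: g1.
  rewrite eI (piM _ _ L0) -/g1 /Tinv -scaleNr addrC (pi_linearl _ _ _ Lg1) (pi1 Lg1).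
  by rewrite (pi_T _ Lg1) tsj addrC scaleNr.
have Ls : gralg_on L (wact w0 g1) by exact: wact_on.
rewrite /target -/g1 eP; set x := tw w0.
have -> : nabla j (x *: wact w0 g1) = x *: nabla j (wact w0 g1).
  have := nabla_linear j x Ls (@gralg_on0 F E L).
  by rewrite nabla0 !addr0.
set h := wact w0 g1 in Ls *; pose b := wact (sr j) (nabla j h).
have ws : wact w0 (wact (sr j') g1) = wact (sr j) h.
  by rewrite /h !wact_comp -ej comp_lfunA longest_invol comp_lfun1l.
have e1 := linear_lincomb (ts j) (ks j) (wact (sr j') g1) (nabla j' g1) g1 (wact_linear w0).
have e2 := linear_lincomb2 x (ts j) (ks j) h (nabla j h) (wact_linear (sr j)).
rewrite ws (longest_nabla Lg1 ej ea) -/h -/b in e1.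
rewrite e1 e2; exact: (scale_lincomb x (ts j) (ks j) (wact (sr j) h) b h).
Qed.

(** Here u = (w_0 w)^-1 lies in W_c and w_0 = wu with lengths adding. The factor t(u) of t(w_0)
    cancels the eigenvalue of T_u^-1, and u fixes [F0]. *)
Lemma target_top w : mr w -> (forall j, a j (w c) <= 0) -> target w = tw w *: wact w F0.
Proof.
move=> mw anti; have Ww := mr_weyl mw; have Ww0 := longest_weyl.
have e := antidominant_fix alcove_ge0 Ww anti.
have Wu : Wc (w0 \o w)%VF by split; [exact: weyl_comp|rewrite /= comp_lfunE].
have Wui := stab_inv Wu; have [Wu' _] := Wu; have [Wui' _] := Wui.
have ew : w0 = (w \o (w0 \o w)^-1)%VF.
  by rewrite weyl_invM // longest_inv weyl_compKV.
rewrite /target (F0_Tw_inv Wui) wactZ scalerA; congr (_ *: _).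
  rewrite {1}ew tw_comp ?mulfK ?tw_neq0 //.
  by rewrite (min_reps_len alcove_ge0).
by rewrite {1}ew -wact_comp; congr wact; have [] := F0_stab Wui.
Qed.

Lemma lcoef_target w : mr w -> lcoef L (w c) G = target w.
Proof.
have [n] := ubnP (len w0 - len w)%N; elim: n w => // n IH w ltn mw.
have Ww := mr_weyl mw.
have [[j gt]|nex] := pselect (exists j, 0 < a j (w c)); last first.
  have anti j : a j (w c) <= 0 by rewrite leNgt; apply/negP => gt; apply: nex; exists j.
  have e1 := lcoef_top mw anti; have e2 := target_top mw anti.
  by rewrite e2; exact: e1.
have [mw1 l] := min_reps_up alcove_ge0 mw gt; have Ww1 := mr_weyl mw1.
have e1 : lcoef L ((sr j \o w)%VF c) G = target (sr j \o w)%VF.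
  apply: IH => //; have [_ max] := longestP; have := max _ Ww1; move: ltn; rewrite l ltnS; lia.
have aj : a j ((sr j \o w)%VF c) < 0 by rewrite comp_lfunE simple_sr oppr_lt0.
have srr : sr j ((sr j \o w)%VF c) = w c by rewrite comp_lfunE reflK ?simple_neq0.
(* The point s_j wc is used because a_j is negative there; its coefficient p is known by induction,
   and the unknown q at wc enters only through s_j q. *)
have := lcoef_qp_T j Ww1 G_orb; rewrite G_T (lt_eqF aj) aj srr e1 (target_step mw gt).
have -> : lcoef L ((sr j \o w)%VF c) (ts j *: G) = ts j *: target (sr j \o w)%VF.
  by rewrite -e1; exact: linearZ.
move: (target _) (lcoef L (w c) _) => p q e.
have {}e : ts j *: p - ks j *: nabla j p = wact (sr j) q + ks j *: wact (sr j) p.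
  exact: (canLR (addrK _) e).
by rewrite e (wactD _ (wact _ q)) wactZ !wact_comp srK !wact1 addrK.
Qed.

End TopCoefficient.

Lemma gamma_formula (f : A) w wh : mr w -> W wh -> gralg_on L f ->
  gamma_qp dot Phi a L c w (piqp (oneW * hg f * Tw wh) (xpow F c)) =
  tw w0 *: wact w0
    (pi (hecke_inv (Tw (w0 \o w)^-1%VF) * symmetrizer dot a t L Wc * Tw wh^-1%VF) f).
Proof.
move=> mw /reduced_ex[s <- rs] Lf.
(* The reversed word is a reduced expression of wh^-1, so T_(wh^-1) is the product that
   [symmetrizer_gralg_hprod] produces. *)
have rs' : reduced dot a (rev s).
  apply/reducedP; rewrite size_rev ((reducedP s).1 rs).
  by rewrite -(len_inv (weyl_word s)) (weyl_invE (weyl_word s) (word_Krev s)).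
rewrite (weyl_invE (weyl_word s) (word_Krev s)) (Tw_word rs) (Tw_word rs').
have Lg : gralg_on L (pi (hprod (rev s)) f) by exact: pi_on.
rewrite symmetrizer_gralg_hprod // qpM (qp_gralg _ Lg).
rewrite (gamma_qpE mw (G_orb Lg)) (lcoef_target Lg mw) /target.
by rewrite -!piM.
Qed.

End HeckeAlgebra.

End RootSystems.

Theorem theorem5p1 (R : realType) (E : vectType R) (dot : {dot E for idfun})
    (Phi : set 'Hom(E, R^o)) (r : nat) (a : 'I_r -> 'Hom(E, R^o))
    (F : fieldType) (t : 'Hom(E, R^o) -> F) (L : set E) (c : E)
    (pi piqp : hecke dot a t L -> gralg F E -> gralg F E)
    (wh w : 'End(E)) (f : gralg F E) :
  irreducible_reduced_root_system dot Phi ->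
  simple_roots Phi a ->
  weyl_invariant dot Phi t ->
  admissible_lattice dot Phi L ->
  C0 dot Phi a L c ->
  polynomial_representation pi ->
  quasi_polynomial_representation piqp ->
  min_reps dot Phi a c wh ->
  min_reps dot Phi a c w ->
  gralg_on L f ->
  let T := heckeTw dot a t L in
  let w0 := longest dot Phi a in
  gamma_qp dot Phi a L c w
    (piqp (symmetrizer dot a t L (weyl dot Phi) * hecke_gralg dot a t L f * T wh)
          (xpow F c))
  = tw dot a t w0 *:
      wact w0
        (pi (hecke_inv (T (w0 \o w)^-1%VF)
             * symmetrizer dot a t L (weyl_stab dot Phi c)
             * T wh^-1%VF) f).
Proof.
move=> HPhi Ha Ht HL Hc Hpi Hqp [Wwh _] mw Lf /=.
exact: (gamma_formula HPhi Ha Ht HL Hpi Hqp Hc mw Wwh Lf).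
Qed.
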